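(* Let $\alpha,\beta>-1$, $p>0$, and \[W(x)=(1-x)^\alpha(1+x)^\beta\,\frac14\begin{pmatrix}4+2p+2px&2(1-x)\\2(1-x)&(1-x)^2\end{pmatrix},\qquad x\in(-1,1).\] Let $B_n,C_n$ be the $2\times2$ recurrence coefficients of the monic matrix orthogonal polynomials $P_n$ for $W$, i.e. $xP_n(x)=P_{n+1}(x)+B_nP_n(x)+C_nP_{n-1}(x)$ with $P_{-1}=0$, $P_0=I_2$. Then as $n\to\infty$, $B_n=\frac{\mathcal B_2}{n^2}+O(n^{-3})$ with \[\mathcal B_2=\frac14\begin{pmatrix}(\beta+1)^2-\alpha^2&0\\0&\beta^2-(\alpha+2)^2\end{pmatrix}-\frac{\alpha+1}{1+p}\begin{pmatrix}1&2p\\ \frac12&-1\end{pmatrix},\] and $C_n=\frac14I_2+O(n^{-2})$.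
   Context: The monic matrix orthogonal polynomial $P_n$ of degree $n$ for $W$ is the unique $2\times2$ matrix polynomial $P_n(x)=x^nI_2+\dots$ with $\int_{-1}^1P_n(x)W(x)P_m(x)^\ast dx=0$ for $m\ne n$. *)

(* Defs.v *)
From HB Require Import structures.
From mathcomp Require Import all_boot all_order all_algebra.
From mathcomp Require Import all_classical all_reals all_analysis.
Set Implicit Arguments. Unset Strict Implicit. Unset Printing Implicit Defensive.
Import Order.TTheory GRing.Theory Num.Theory.
Local Open Scope classical_set_scope.
Local Open Scope ring_scope.

Definition mx22 {R : nzRingType} (a b c d : R) : 'M[R]_2 :=
  \matrix_(i < 2, j < 2)
    if i == 0 then (if j == 0 then a else b) else (if j == 0 then c else d).

Definition Wt {R : realType} (al be p : R) (x : R) : 'M[R]_2 :=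
  ((powR (1 - x) al * powR (1 + x) be) / 4) *:
    mx22 (4 + 2 * p + 2 * p * x) (2 * (1 - x)) (2 * (1 - x)) ((1 - x) ^+ 2).

Definition mxpeval {R : nzRingType} (P : 'M[{poly R}]_2) (x : R) : 'M[R]_2 :=
  map_mx (fun q => q.[x]) P.

Definition mx_int {R : realType} (F : R -> 'M[R]_2) : 'M[R]_2 :=
  \matrix_(i < 2, j < 2)
    Rintegral (@lebesgue_measure R) `]-1, 1[ (fun x => F x i j).

Definition monic_mxpoly_deg {R : nzRingType} (n : nat) (P : 'M[{poly R}]_2) :=
  forall i j : 'I_2, (size (P i j - ((i == j)%:R * 'X^n))%R <= n)%N.

Definition monic_MOPS {R : realType} (W : R -> 'M[R]_2)
    (P : nat -> 'M[{poly R}]_2) :=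
  (forall n, monic_mxpoly_deg n (P n)) /\
  (forall n m, n <> m ->
     mx_int (fun x => mxpeval (P n) x *m W x *m (mxpeval (P m) x)^T) = 0).

Definition three_term {R : nzRingType} (P : nat -> 'M[{poly R}]_2)
    (B C : nat -> 'M[R]_2) :=
  ('X%:M *m P 0 = P 1 + map_mx polyC (B 0) *m P 0) /\
  (forall n, (1 <= n)%N ->
     'X%:M *m P n = P n.+1 + map_mx polyC (B n) *m P n
                      + map_mx polyC (C n) *m P n.-1).

(* Main.v *)
(* With z = 1 + x and w the Jacobi weight, the pairing of two row polynomials (a, b), (c, d)
   is the integral of w (f g + 2 p z a c) / 4, where f = 2 a + (2 - z) b, g = 2 c + (2 - z) d
   are tied to a, c only by f = 2 a, g = 2 c at z = 2.  Testing a row of P_n against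
   ((2 - z) r, - 2 r) and (0, r) shows that a and f are combinations of two consecutive
   Jacobi polynomials of parameters (al + 1, be + 1) and (al + 1, be); the constraint at
   z = 2 and the test row (1, 0) give a 2 x 2 linear system for the remaining coefficients.
   Hence the two subleading coefficients X_n, Y_n of P_n are explicit rational functions
   of n, and B_n + 1 = X_n - X_(n+1), C_n = Y_n - Y_(n+1) - (B_n + 1) X_n in the variable z,
   so the theorem follows by expanding X_n and Y_n in powers of 1 / n. *)
Require Import Defs.
From HB Require Import structures.
From mathcomp Require Import all_boot all_order all_algebra.
From mathcomp Require Import all_classical all_reals all_analysis.
From mathcomp Require Import measurable_realfun ring lra.
Import Order.TTheory GRing.Theory Num.Theory.
Import numFieldNormedType.Exports.
Local Open Scope classical_set_scope.
Local Open Scope ring_scope.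

(** Two Jacobi polynomials survive in [a] and in [f] because each degree exceeds the order of
    orthogonality by one: [a] has degree n but is tested only up to degree n - 2, since the factor 2
    - z of the test row costs one degree, and [f] has degree n + 1 and is tested up to n - 1.
    Monicity fixes the top coefficients, so one unknown per function remains. The row (1, 0) pairs
    [f] and [a] with a weight whose exponent at x = 1 is one below that of their Jacobi polynomials,
    so orthogonality does not kill this moment and a closed form is needed. The Chu-Vandermonde sum
    supplies it, as well as orthogonality, norms and values at z = 2. Of the Beta integral only
    positivity and one recurrence enter, since its value cancels from the linear system. X_n grows
    like -n I and Y_n like n^2 I / 2, so X_n / n and Y_n / n^2 are expanded. In C_n the terms of
    order n cancel, and those of order 1 / n cancel because the leading coefficient of X_n is scalar
    and commutes with the matrix [B2]. *)

Section JacobiWeight.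
Context {R : realType}.
Implicit Types (a b x : R) (n : nat).
Notation mu := (@lebesgue_measure R).

(** * The scalar Jacobi weight and its integrals over truncated intervals *)

Definition jacobi_weight a b x : R := (1 - x) `^ a * (1 + x) `^ b.

Lemma jacobi_weight_ge0 a b x : 0 <= jacobi_weight a b x.
Proof. by rewrite mulr_ge0 ?powR_ge0. Qed.

Lemma jacobi_weight_gt0 a b x : -1 < x < 1 -> 0 < jacobi_weight a b x.
Proof. by move=> /andP[? ?]; rewrite mulr_gt0 ?powR_gt0 //; lra. Qed.

Lemma jacobi_weightSl a b x : -1 < x < 1 ->
  jacobi_weight (a + 1) b x = (1 - x) * jacobi_weight a b x.
Proof.
move=> /andP[? ?]; have x0 : 0 < 1 - x by lra.
have h : (a + 1 == 0) ==> (1 - x != 0) by apply/implyP => _; rewrite gt_eqF.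
rewrite /jacobi_weight (powRD h) powRr1 ?ltW //; ring.
Qed.

Lemma jacobi_weightSr a b x : -1 < x < 1 ->
  jacobi_weight a (b + 1) x = (1 + x) * jacobi_weight a b x.
Proof.
move=> /andP[? ?]; have x0 : 0 < 1 + x by lra.
have h : (b + 1 == 0) ==> (1 + x != 0) by apply/implyP => _; rewrite gt_eqF.
rewrite /jacobi_weight (powRD h) powRr1 ?ltW //; ring.
Qed.

Lemma is_derive_jacobi_weight a b x : -1 < x < 1 ->
  is_derive x (1 : R) (jacobi_weight (a + 1) (b + 1))
    ((b + 1) * jacobi_weight (a + 1) b x - (a + 1) * jacobi_weight a (b + 1) x).
Proof.
move=> /andP[x1 x2].
have d1 : is_derive x (1 : R) (fun t : R => 1 - t) (-1).
  by apply: is_derive_eq; lra.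
have d2 : is_derive x (1 : R) (fun t : R => 1 + t) 1.
  by apply: is_derive_eq; lra.
have x1' : 0 < 1 - x by lra.
have x2' : 0 < 1 + x by lra.
have h1 := @is_derive1_comp _ _ (fun t : R => 1 - t) x _ _ (is_derive1_powR (a + 1) x1') d1.
have h2 := @is_derive1_comp _ _ (fun t : R => 1 + t) x _ _ (is_derive1_powR (b + 1) x2') d2.
rewrite !addrK in h1 h2.
have := is_deriveM h1 h2.
have -> : ((fun t : R => powR t (a + 1)) \o (fun t : R => 1 - t)) *
  ((fun t : R => powR t (b + 1)) \o (fun t : R => 1 + t)) = jacobi_weight (a + 1) (b + 1).
  by [].
move=> H; apply: is_derive_eq H _.
rewrite /jacobi_weight /GRing.scale /=; ring.
Qed.

Lemma continuous_jacobi_weight a b x : -1 < x < 1 ->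
  {for x, continuous (jacobi_weight a b)}.
Proof.
move=> xab.
apply/differentiable_continuous/derivable1_diffP.
have := @is_derive_jacobi_weight (a - 1) (b - 1) x xab.
by rewrite !subrK => -[].
Qed.

Lemma measurable_jacobi_weight a b : measurable_fun setT (jacobi_weight a b).
Proof.
apply: measurable_funM.
  by apply: (measurableT_comp (measurable_powR _)); exact: measurable_funB.
by apply: (measurableT_comp (measurable_powR _)); exact: measurable_funD.
Qed.

(* For a, b < 0 the weight is unbounded at the end points, so the fundamental theorem of
   calculus is applied on the segments [-r_n, r_n] exhausting ]-1, 1[. *)
Definition trunc_radius n : R := 1 - (n.+2%:R)^-1.

Lemma trunc_radius_bounds n : 0 < trunc_radius n < 1.
Proof.
rewrite /trunc_radius.
have h0 : (0 : R) < n.+2%:R^-1 by rewrite invr_gt0 ltr0n.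
have h1 : (n.+2%:R^-1 : R) < 1 by rewrite invf_lt1 ?ltr0n // ltr1n.
by move: (n.+2%:R^-1) h0 h1 => u ? ?; apply/andP; split; lra.
Qed.

Lemma trunc_radius_cvg : trunc_radius n @[n --> \oo] --> (1 : R).
Proof.
rewrite -[X in _ --> X]subr0; apply: cvgB; first exact: cvg_cst.
rewrite /=.
have := @cvg_harmonic R; rewrite -cvg_shiftS => H.
apply: cvg_trans H.
exact: cvg_refl.
Qed.

Definition inner_itv n : set R := `[- trunc_radius n, trunc_radius n].

Lemma nondecreasing_inner_itv : nondecreasing_seq inner_itv.
Proof.
apply/nondecreasing_seqP => n; rewrite subsetEset => x.
rewrite /inner_itv /= !in_itv /= /trunc_radius => /andP[h1 h2].
have h : (n.+3%:R^-1 : R) <= n.+2%:R^-1.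
  by rewrite lef_pV2 ?ler_nat // posrE ltr0n.
by move: (n.+3%:R^-1) (n.+2%:R^-1) h h1 h2 => u v ? ? ?; apply/andP; split; lra.
Qed.

Lemma bigcup_inner_itv : \bigcup_n inner_itv n = [set` `]-1, 1[].
Proof.
apply/seteqP; split => x /=.
  move=> [n _]; rewrite /inner_itv /= !in_itv /= => /andP[h1 h2].
  by have /andP[? ?] := trunc_radius_bounds n; apply/andP; split; lra.
rewrite in_itv /= => /andP[h1 h2].
have x1 : `|x| < 1 by rewrite ltr_norml h1 h2.
have : \forall n \near \oo, `|x| < trunc_radius n.
  exact: (cvgr_gt (1 : R) trunc_radius_cvg).
move=> [n _ /(_ n (leqnn n)) /= hn].
exists n => //; rewrite /inner_itv /= in_itv /=.
by rewrite -ler_norml ltW.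
Qed.

Lemma inner_itv_sub n x : inner_itv n x -> -1 < x < 1.
Proof.
move=> h; have : (\bigcup_n inner_itv n) x by exists n.
by rewrite bigcup_inner_itv /= in_itv.
Qed.

Lemma within_continuous_jacobi_weight n a b :
  {within inner_itv n, continuous (jacobi_weight a b)}.
Proof.
apply: continuous_in_subspaceT => x; rewrite inE => /inner_itv_sub h.
exact: continuous_jacobi_weight.
Qed.

Lemma integrable_trunc n a b :
  mu.-integrable (inner_itv n) (EFin \o jacobi_weight a b).
Proof.
apply: continuous_compact_integrable; first exact: segment_compact.
exact: within_continuous_jacobi_weight.
Qed.

Definition trunc_int a b n : R :=
  Rintegral mu (inner_itv n) (jacobi_weight a b).

Definition trunc_bdry a b n : R :=
  jacobi_weight a b (trunc_radius n) - jacobi_weight a b (- trunc_radius n).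

(** Integrates (1 - x) + (1 + x) = 2 against the weight. *)
Lemma trunc_intD a b n :
  trunc_int (a + 1) b n + trunc_int a (b + 1) n = 2 * trunc_int a b n.
Proof.
have mT : measurable (inner_itv n) by exact: measurable_itv.
rewrite /trunc_int -RintegralD //; try exact: integrable_trunc.
rewrite -[RHS](@RintegralZl _ _ _ mu (inner_itv n) (jacobi_weight a b) 2 _ (integrable_trunc
    n a b)) //.
apply: eq_Rintegral => x; rewrite inE => /inner_itv_sub h /=.
rewrite -/(jacobi_weight (a + 1) b x) -/(jacobi_weight a (b + 1) x).
rewrite jacobi_weightSl // jacobi_weightSr //; ring.
Qed.

(** The fundamental theorem of calculus for the weight with both exponents raised by one. Together
    with [trunc_intD] it relates the integrals at (a, b), (a + 1, b) and (a, b + 1) by two linear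
    equations. *)
Lemma trunc_int_parts a b n :
  (b + 1) * trunc_int (a + 1) b n - (a + 1) * trunc_int a (b + 1) n
  = trunc_bdry (a + 1) (b + 1) n.
Proof.
have /andP[r0 r1] := trunc_radius_bounds n.
have rr : - trunc_radius n < trunc_radius n by lra.
have int1 := integrable_trunc n (a + 1) b.
have int2 := integrable_trunc n a (b + 1).
have mT : measurable (inner_itv n) by exact: measurable_itv.
rewrite /trunc_int -(@RintegralZl _ _ _ mu _ _ _ _ int1) // -(@RintegralZl _ _ _ mu _ _ _ _
    int2) //.
rewrite -RintegralB //; last 2 first.
- have := @integrableZl _ _ _ mu (inner_itv n) mT (b + 1) _ int1.
  by apply: eq_integrable.
- have := @integrableZl _ _ _ mu (inner_itv n) mT (a + 1) _ int2.
  by apply: eq_integrable.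
rewrite /Rintegral.
have inT x : - trunc_radius n <= x <= trunc_radius n -> -1 < x < 1.
  by move=> /andP[? ?]; apply/andP; split; lra.
rewrite (@continuous_FTC2 _ _ (jacobi_weight (a + 1) (b + 1))) //.
- apply: continuous_in_subspaceT => x; rewrite inE => /inner_itv_sub h.
  apply: cvgB; apply: cvgM; try exact: cvg_cst; exact: continuous_jacobi_weight.
- split.
  + move=> x; rewrite in_itv /= => /andP[h1 h2].
    have hx : -1 < x < 1 by apply: inT; rewrite !ltW.
    by have [] := is_derive_jacobi_weight a b x hx.
  + apply: cvg_at_right_filter; apply: continuous_jacobi_weight.
    by apply: inT; rewrite lexx ltW.
  + apply: cvg_at_left_filter; apply: continuous_jacobi_weight.
    by apply: inT; rewrite lexx ltW.
- move=> x; rewrite in_itv /= => /andP[h1 h2].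
  rewrite derive1E.
  have hx : -1 < x < 1 by apply: inT; rewrite !ltW.
  by have [_ ->] := is_derive_jacobi_weight a b x hx.
Qed.

Lemma jacobi_weight_le a b x : 0 <= a -> 0 <= b -> -1 < x < 1 ->
  jacobi_weight a b x <= 2 `^ a * 2 `^ b.
Proof.
move=> a0 b0 /andP[x1 x2].
apply: ler_pM; rewrite ?powR_ge0 //.
  by apply: ge0_ler_powR; rewrite ?nnegrE //; lra.
by apply: ge0_ler_powR; rewrite ?nnegrE //; lra.
Qed.

(** At each end one factor is a positive power of 1 / (n + 2), while the other stays below a power
    of 2. *)
Lemma trunc_bdry_cvg a b : 0 < a -> 0 < b -> trunc_bdry a b n @[n --> \oo] --> (0 : R).
Proof.
move=> a0 b0.
have pw c : 0 < c -> (n.+2%:R^-1 : R) `^ c @[n --> \oo] --> (0 : R).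
  move=> c0; have /cvg_at_rightP := powR_cvg0 c0.
  move=> /(_ (fun n : nat => n.+2%:R^-1)); apply; split.
    by move=> n; rewrite invr_gt0 ltr0n.
  by have := @cvg_harmonic R; rewrite -cvg_shiftS.
have lim0 c d : 0 < c -> 0 < d ->
    (n.+2%:R^-1 : R) `^ c * (1 + trunc_radius n) `^ d @[n --> \oo] --> (0 : R).
  move=> c0 d0; apply: (@squeeze_cvgr _ _ _ _ (fun=> 0) (fun n => n.+2%:R^-1 `^ c * 2 `^
      d)).
  - near=> n; rewrite mulr_ge0 ?powR_ge0 //=.
    rewrite ler_wpM2l ?powR_ge0 //.
    have /andP[h1 h2] := trunc_radius_bounds n.
    by apply: ge0_ler_powR; rewrite ?nnegrE ?ltW //; lra.
  - exact: cvg_cst.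
  - by rewrite -(mul0r (2 `^ d)); apply: cvgM; [exact: pw | exact: cvg_cst].
rewrite -[X in _ --> X](subrr 0).
apply: cvgB.
  apply: cvg_trans (lim0 a b a0 b0); apply: near_eq_cvg; near=> n.
  by rewrite /jacobi_weight {2}/trunc_radius subKr.
apply: cvg_trans (lim0 b a b0 a0); apply: near_eq_cvg; near=> n.
rewrite /jacobi_weight opprK mulrC; congr (_ * _).
by rewrite /trunc_radius opprB addrC subrK.
Unshelve. all: by end_near. Qed.

(* Integration by parts bounds the truncated integrals for (a, b) by those for (a + 1, b)
   and (a, b + 1), which reduces the claim to bounded weights. *)
Lemma trunc_int_bounded a b : -1 < a -> -1 < b ->
  exists M : R, forall n, trunc_int a b n <= M.
Proof.
have pos c d : 0 <= c -> 0 <= d -> exists M : R, forall n, trunc_int c d n <= M.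
  move=> c0 d0; exists (2 `^ c * 2 `^ d * 2) => n.
  have mT : measurable (inner_itv n) by exact: measurable_itv.
  apply: (@le_trans _ _ (Rintegral mu (inner_itv n) (cst (2 `^ c * 2 `^ d)))).
    apply: le_Rintegral => //; first exact: integrable_trunc.
      apply: continuous_compact_integrable; first exact: segment_compact.
      by move=> ?; exact: cvg_cst.
    by move=> x /inner_itv_sub h; exact: jacobi_weight_le.
  have /andP[r0 r1] := trunc_radius_bounds n.
  rewrite Rintegral_cst // ler_wpM2l ?mulr_ge0 ?powR_ge0 //.
  rewrite /inner_itv /= lebesgue_measure_itv /= lte_fin ifT /=; lra.
have bdry c d n : 0 <= c -> 0 <= d -> `|trunc_bdry c d n| <= 2 `^ c * 2 `^ d.
  move=> c0 d0; have /andP[r0 r1] := trunc_radius_bounds n.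
  have p1 := jacobi_weight_ge0 c d (trunc_radius n).
  have p2 := jacobi_weight_ge0 c d (- trunc_radius n).
  have q1 : jacobi_weight c d (trunc_radius n) <= 2 `^ c * 2 `^ d.
    by apply: jacobi_weight_le => //; apply/andP; split; lra.
  have q2 : jacobi_weight c d (- trunc_radius n) <= 2 `^ c * 2 `^ d.
    by apply: jacobi_weight_le => //; apply/andP; split; lra.
  by rewrite /trunc_bdry ler_norml; apply/andP; split; lra.
(* Eliminating the integral at (c + 1, d) from [trunc_intD] and [trunc_int_parts] expresses 2 (d +
   1) times the integral at (c, d) through the one at (c, d + 1) and a boundary term; d > -1 allows
   the division. [stepl] is the mirror image. *)
have stepr c d : 0 <= c + 1 -> -1 < d ->
    (exists M : R, forall n, trunc_int c (d + 1) n <= M) ->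
    exists M : R, forall n, trunc_int c d n <= M.
  move=> c0 d0 [M HM].
  exists (((c + d + 2) * M + 2 `^ (c + 1) * 2 `^ (d + 1)) / (2 * (d + 1))) => n.
  have d0' : 0 <= d + 1 by lra.
  have d2 : 0 < 2 * (d + 1) by lra.
  have s0 : 0 <= c + d + 2 by lra.
  have := bdry (c + 1) (d + 1) n c0 d0'; rewrite ler_norml => /andP[_ hb].
  have := trunc_intD c d n; have := trunc_int_parts c d n => e1 e2.
  rewrite ler_pdivlMr //.
  have -> : trunc_int c d n * (2 * (d + 1)) =
    (c + d + 2) * trunc_int c (d + 1) n + trunc_bdry (c + 1) (d + 1) n.
    rewrite mulrCA mulrA mulrC -e2 -e1 {HM hb e1 e2}.
    by move: (trunc_int _ _ _) (trunc_int _ _ _) => u v; ring.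
  by apply: lerD => //; rewrite ler_wpM2l.
have stepl c d : -1 < c -> 0 <= d + 1 ->
    (exists M : R, forall n, trunc_int (c + 1) d n <= M) ->
    exists M : R, forall n, trunc_int c d n <= M.
  move=> c0 d0 [M HM].
  exists (((c + d + 2) * M + 2 `^ (c + 1) * 2 `^ (d + 1)) / (2 * (c + 1))) => n.
  have c0' : 0 <= c + 1 by lra.
  have c2 : 0 < 2 * (c + 1) by lra.
  have s0 : 0 <= c + d + 2 by lra.
  have := bdry (c + 1) (d + 1) n c0' d0; rewrite ler_norml => /andP[hb _].
  have := trunc_intD c d n; have := trunc_int_parts c d n => e1 e2.
  rewrite ler_pdivlMr //.
  have -> : trunc_int c d n * (2 * (c + 1)) =
    (c + d + 2) * trunc_int (c + 1) d n - trunc_bdry (c + 1) (d + 1) n.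
    rewrite mulrCA mulrA mulrC -e2 -e1 {HM hb e1 e2}.
    by move: (trunc_int _ _ _) (trunc_int _ _ _) => u v; ring.
  by apply: lerD; [rewrite ler_wpM2l | rewrite lerNl].
move=> a1 b1; apply: stepl => //; first lra.
apply: stepr => //; first lra.
by apply: pos; lra.
Qed.

End JacobiWeight.

(** * The Jacobi integral over the whole interval and its functional on polynomials *)

Section JacobiIntegral.
Context {R : realType}.
Implicit Types (a b x : R) (n : nat) (q : {poly R}).
Notation mu := (@lebesgue_measure R).
Notation itv11 := (`](-1)%R, 1%R[%classic : set R).

Definition jacobi_int a b : R :=
  Rintegral mu `]-1, 1[ (jacobi_weight a b).

Lemma trunc_integral_cvg a b :
  (\int[mu]_(x in inner_itv n) (jacobi_weight a b x)%:E)%E @[n --> \oo] -->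
  (\int[mu]_(x in itv11) (jacobi_weight a b x)%:E)%E.
Proof.
rewrite -bigcup_inner_itv; apply: ge0_nondecreasing_set_cvg_integral.
- exact: nondecreasing_inner_itv.
- by move=> n; exact: measurable_itv.
- move=> n; apply/measurable_EFinP; apply: measurable_funTS.
  exact: measurable_jacobi_weight.
- by move=> n x _; rewrite lee_fin jacobi_weight_ge0.
Qed.

Lemma trunc_intE a b n :
  (\int[mu]_(x in inner_itv n) (jacobi_weight a b x)%:E)%E = (trunc_int a b n)%:E.
Proof.
rewrite /trunc_int /Rintegral fineK //.
apply: integrable_fin_num; first exact: measurable_itv.
exact: integrable_trunc.
Qed.

(** Monotone convergence turns the uniform bound on the truncated integrals into a finite
    integral. *)
Lemma integrable_jacobi_weight a b : -1 < a -> -1 < b ->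
  mu.-integrable `]-1, 1[ (EFin \o jacobi_weight a b).
Proof.
move=> a1 b1; apply/integrableP; split.
  apply/measurable_EFinP; apply: measurable_funTS.
  exact: measurable_jacobi_weight.
under eq_integral => x _ do rewrite /= ger0_norm ?jacobi_weight_ge0 //.
have [M HM] := trunc_int_bounded a b a1 b1.
apply: (@le_lt_trans _ _ M%:E); last exact: ltry.
have H := @trunc_integral_cvg a b.
apply: (@closed_cvg _ _ _ _ _ (fun x : \bar R => (x <= M%:E)%E) _ _ _ H) => //.
  exact: closed_ereal_ge_ereal.
by near=> n; rewrite trunc_intE lee_fin.
Unshelve. all: by end_near. Qed.

Lemma trunc_int_cvg a b : -1 < a -> -1 < b ->
  trunc_int a b n @[n --> \oo] --> jacobi_int a b.
Proof.
move=> a1 b1.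
have H := @trunc_integral_cvg a b.
have : (\int[mu]_(x in itv11) (jacobi_weight a b x)%:E)%E = (jacobi_int a b)%:E.
  rewrite /jacobi_int /Rintegral fineK //.
  apply: integrable_fin_num; first exact: measurable_itv.
  exact: integrable_jacobi_weight.
move=> E; rewrite E in H.
by move/fine_cvgP : H => -[].
Qed.

(** The recurrence of the Beta integral: eliminating the integral at (a + 1, b) from the two
    truncated relations leaves a boundary term that vanishes in the limit. *)
Lemma jacobi_intSr a b : -1 < a -> -1 < b ->
  jacobi_int a (b + 1) = 2 * (b + 1) / (a + b + 2) * jacobi_int a b.
Proof.
move=> a1 b1.
have ab0 : a + b + 2 != 0 by rewrite gt_eqF //; lra.
have b2 : -1 < b + 1 by lra.
have a2 : -1 < a + 1 by lra.
have : (a + b + 2) * trunc_int a (b + 1) n - 2 * (b + 1) * trunc_int a b n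
    @[n --> \oo] --> (a + b + 2) * jacobi_int a (b + 1) - 2 * (b + 1) * jacobi_int a b.
  by apply: cvgB; apply: cvgM; try exact: cvg_cst; exact: trunc_int_cvg.
have : (- trunc_bdry (a + 1) (b + 1) n) @[n --> \oo] --> (- 0 : R).
  by apply: cvgN; apply: trunc_bdry_cvg; lra.
have -> : (fun n => (a + b + 2) * trunc_int a (b + 1) n - 2 * (b + 1) * trunc_int a b n)
  = (fun n => - trunc_bdry (a + 1) (b + 1) n).
  apply/funext => n; rewrite -trunc_int_parts.
  have -> : 2 * (b + 1) * trunc_int a b n = (b + 1) * (2 * trunc_int a b n) by ring.
  rewrite -trunc_intD; ring.
move=> h1 h2.
have /esym/eqP : - 0 = (a + b + 2) * jacobi_int a (b + 1) - 2 * (b + 1) * jacobi_int a b.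
  exact: cvg_unique h1 h2.
rewrite oppr0 subr_eq0 => /eqP e.
apply: (mulfI ab0); rewrite e; field; exact: ab0.
Qed.

(** A zero integral would force the weight to vanish almost everywhere, but it is positive on an
    interval of measure 2. *)
Lemma jacobi_int_gt0 a b : -1 < a -> -1 < b -> 0 < jacobi_int a b.
Proof.
move=> a1 b1.
have int := @integrable_jacobi_weight a b a1 b1.
rewrite lt_neqAle; apply/andP; split; last first.
  by apply: Rintegral_ge0 => x _; exact: jacobi_weight_ge0.
apply/negP => /eqP e0.
have mI : measurable (`]-1, 1[%classic : set (measurableTypeR R)) by exact: measurable_itv.
have [+ _] := ae_eq_integral_abs mu mI (integrableP _ _ _ int).1.
have -> : (\int[mu]_(x in itv11) `|(EFin \o jacobi_weight a b) x|)%E = 0%E.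
  under eq_integral => x _ do rewrite /= ger0_norm ?jacobi_weight_ge0 //.
  move: e0; rewrite /jacobi_int /Rintegral => e0.
  rewrite -[LHS]fineK ?e0 -?e0 //.
  exact: (integrable_fin_num mI int).
move=> /(_ erefl) [A [mA A0 sub]].
have : (mu itv11 <= mu A)%E.
  apply: le_measure; rewrite ?inE //.
  move=> x /= hx; apply: sub => /= /(_ hx) /eqP.
  rewrite /cst eqe gt_eqF //; apply: jacobi_weight_gt0; by rewrite in_itv in hx.
rewrite A0 lebesgue_measure_itv /= lte_fin ifT; last by lra.
rewrite -EFinB lee_fin; lra.
Qed.

(* Polynomials are in the variable z = 1 + x. *)
Definition jacobi_fun a b q : R :=
  Rintegral mu `]-1, 1[ (fun x => jacobi_weight a b x * q.[1 + x]).

Lemma measurable_horner q : measurable_fun setT (fun x : R => q.[1 + x]).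
Proof.
apply: continuous_measurable_fun => x.
apply: (@continuous_comp _ _ _ (fun t : R => 1 + t) (fun t => q.[t])).
  by apply: cvgD; [exact: cvg_cst | exact: cvg_id].
exact: continuous_horner.
Qed.

Lemma integrable_jacobi_poly a b q : -1 < a -> -1 < b ->
  mu.-integrable `]-1, 1[ (EFin \o (fun x => jacobi_weight a b x * q.[1 + x])).
Proof.
move=> a1 b1.
have int := @integrable_jacobi_weight a b a1 b1.
have mI : measurable (itv11 : set (measurableTypeR R)) by exact: measurable_itv.
have mq : measurable_fun (itv11 : set (measurableTypeR R)) (fun x : R => q.[1 + x]).
  by apply: measurable_funTS; exact: measurable_horner.
have bq : [bounded q.[1 + x] | x in (itv11 : set R)].
  have [M HM] : exists M : R, forall x, -1 < x < 1 -> `|q.[1 + x]| <= M.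
    exists (\sum_(i < size q) `|q`_i| * 2 ^+ i) => x /andP[x1 x2].
    rewrite horner_coef; apply: (le_trans (ler_norm_sum _ _ _)).
    apply: ler_sum => i _; rewrite normrM ler_wpM2l // normrX.
    rewrite lerXn2r ?nnegrE //; rewrite ger0_norm; lra.
  exists M; split; first exact: num_real.
  move=> y My x; rewrite /= in_itv /= => hx; apply: le_trans (HM _ hx) _; exact: ltW.
have := @integrableMl _ _ _ mu itv11 mI _ _ int mq bq.
by apply: eq_integrable => // x _; rewrite /= EFinM.
Qed.

Lemma jacobi_funD a b q r : -1 < a -> -1 < b ->
  jacobi_fun a b (q + r) = jacobi_fun a b q + jacobi_fun a b r.
Proof.
move=> a1 b1; rewrite /jacobi_fun -RintegralD //; try exact: integrable_jacobi_poly.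
by apply: eq_Rintegral => x _; rewrite hornerD mulrDr.
Qed.

Lemma jacobi_funZ a b k q : -1 < a -> -1 < b ->
  jacobi_fun a b (k *: q) = k * jacobi_fun a b q.
Proof.
move=> a1 b1; rewrite /jacobi_fun.
rewrite -[RHS](@RintegralZl _ _ _ mu itv11 _ k _ (integrable_jacobi_poly a b q a1 b1)) //.
by apply: eq_Rintegral => x _; rewrite hornerZ mulrCA.
Qed.

Lemma jacobi_funMl a b q :
  jacobi_fun a b ((2%:P - 'X) * q) = jacobi_fun (a + 1) b q.
Proof.
apply: eq_Rintegral => x; rewrite inE /= in_itv /= => hx.
rewrite jacobi_weightSl // hornerM hornerD hornerN hornerC hornerX.
by rewrite mulrCA mulrA; congr (_ * _ * _); rewrite opprD addrA addrK.
Qed.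

Lemma jacobi_funMr a b q : jacobi_fun a b ('X * q) = jacobi_fun a (b + 1) q.
Proof.
apply: eq_Rintegral => x; rewrite inE /= in_itv /= => hx.
by rewrite jacobi_weightSr // hornerM hornerX mulrCA mulrA.
Qed.

Lemma jacobi_fun1 a b : jacobi_fun a b 1 = jacobi_int a b.
Proof. by apply: eq_Rintegral => x _; rewrite hornerE mulr1. Qed.

End JacobiIntegral.

(** * Rising factorials and the Chu-Vandermonde sum *)

Section RisingFactorial.
Context {R : realFieldType}.
Implicit Types (x c d : R) (n k : nat).

(** The Pochhammer symbol (x)_n. *)
Definition rfact x n : R := \prod_(i < n) (x + i%:R).

Lemma rfact0 x : rfact x 0 = 1.
Proof. by rewrite /rfact big_ord0. Qed.

Lemma rfactSr x n : rfact x n.+1 = rfact x n * (x + n%:R).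
Proof. by rewrite /rfact big_ord_recr. Qed.

Lemma rfactSl x n : rfact x n.+1 = x * rfact (x + 1) n.
Proof.
rewrite /rfact big_ord_recl addr0; congr (_ * _).
by apply: eq_bigr => i _; rewrite -addrA nat1r.
Qed.

Lemma rfact_gt0 x n : 0 < x -> 0 < rfact x n.
Proof. by move=> x0; rewrite prodr_gt0 // => i _; rewrite ltr_pwDl. Qed.

Lemma rfact_neq0 x n : 0 < x -> rfact x n != 0.
Proof. by move=> x0; rewrite gt_eqF // rfact_gt0. Qed.

(** The factor of index n - j - 1 is zero. *)
Lemma rfact_eq0 j n : (j < n)%N -> rfact (j.+1%:R - n%:R) n = 0.
Proof.
move=> jn; have h : (n - j.+1 < n)%N by rewrite ltn_subrL (leq_trans _ jn).
rewrite /rfact (bigD1 (Ordinal h)) //= natrB // addrC subrKA subrr mul0r.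
by [].
Qed.

Lemma rfact_opp x n : rfact (- x - n%:R) n = (-1) ^+ n * rfact (x + 1) n.
Proof.
rewrite /rfact (reindex_inj rev_ord_inj) /=.
rewrite -[X in _ ^+ X]card_ord -prodr_const -big_split /=.
apply: eq_bigr => i _; rewrite natrB // -addn1 natrD; ring.
Qed.

(** The sum is the terminating series 2F1(-n, d; c; 1). Pascal's rule writes the sum for n + 1 as
    the one for n at (d, c) minus d / c times the one for n at (d + 1, c + 1). Both pairs have the
    same difference c - d, so the two closed forms combine. *)
Lemma chu_vandermonde n d c : 0 < c ->
  \sum_(k < n.+1) (-1) ^+ k * 'C(n, k)%:R * (rfact d k / rfact c k)
  = rfact (c - d) n / rfact c n.
Proof.
elim: n d c => [|n IHn] d c c0; first by rewrite big_ord1 !rfact0 bin0 /=; field.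
have c1 : 0 < c + 1 by lra.
have cn0 : c != 0 by rewrite gt_eqF.
rewrite big_ord_recl /=.
have -> : \sum_(i < n.+1) (-1) ^+ bump 0 i * 'C(n.+1, bump 0 i)%:R *
      (rfact d (bump 0 i) / rfact c (bump 0 i)) =
    \sum_(i < n.+1) (-1) ^+ i.+1 * 'C(n, i.+1)%:R * (rfact d i.+1 / rfact c i.+1) -
    d / c * \sum_(i < n.+1) (-1) ^+ i * 'C(n, i)%:R *
      (rfact (d + 1) i / rfact (c + 1) i).
  rewrite mulr_sumr -sumrB; apply: eq_bigr => i _.
  rewrite /bump /= add1n binS natrD exprS !rfactSl.
  have := rfact_neq0 (c + 1) i c1 => h; field.
  by rewrite h cn0.
rewrite IHn // opprD addrACA subrr addr0 addrA.
have -> : (-1) ^+ 0 * 'C(n.+1, 0)%:R * (rfact d 0 / rfact c 0) +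
  \sum_(i < n.+1) (-1) ^+ i.+1 * 'C(n, i.+1)%:R * (rfact d i.+1 / rfact c i.+1)
  = \sum_(i < n.+2) (-1) ^+ i * 'C(n, i)%:R * (rfact d i / rfact c i).
  by rewrite [RHS]big_ord_recl /= !bin0; congr (_ + _); apply: eq_bigr => i _.
rewrite big_ord_recr /= (bin_small (leqnn n.+1)) mulr0 mul0r addr0 IHn //.
have h1 := rfact_neq0 (c + 1) n c1.
have h2 := rfact_neq0 c n c0.
have hc : rfact (c + 1) n = rfact c n * (c + n%:R) / c.
  by rewrite -rfactSr rfactSl; field; rewrite cn0.
have hn : c + n%:R != 0 by rewrite gt_eqF // ltr_pwDl.
rewrite hc !rfactSr; field.
by rewrite h2 hn cn0.
Qed.

End RisingFactorial.

(** * Monic Jacobi polynomials: coefficients, values, orthogonality *)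

Section JacobiPolynomial.
Context {R : realType}.
Implicit Types (a b : R) (n k : nat) (q r : {poly R}).

Definition jacobi_scale n a b : R :=
  (-2) ^+ n * rfact (b + 1) n / rfact (n%:R + a + b + 1) n.

(** Coefficient of z^k in 2F1(-n, n + a + b + 1; b + 1; z / 2), with (-n)_k / k! written as a signed
    binomial. [jacobi_scale] normalizes the leading coefficient to 1. *)
Definition jacobi_coef n a b k : R :=
  (-1) ^+ k * 'C(n, k)%:R * rfact (n%:R + a + b + 1) k / (2 ^+ k * rfact (b + 1) k).

(* The monic Jacobi polynomial of degree n, expanded in powers of z = 1 + x. *)
Definition jacobi_poly n a b : {poly R} :=
  \poly_(k < n.+1) (jacobi_scale n a b * jacobi_coef n a b k).

Lemma coef_jacobi_poly n a b k :
  (jacobi_poly n a b)`_k = jacobi_scale n a b * jacobi_coef n a b k.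
Proof.
rewrite coef_poly; case: ltnP => // h.
by rewrite /jacobi_coef bin_small // mulr0 !mul0r mulr0.
Qed.

Lemma size_jacobi_poly n a b : (size (jacobi_poly n a b) <= n.+1)%N.
Proof. exact: size_poly. Qed.

(** The ratio of consecutive hypergeometric terms; descending from the leading coefficient 1, it
    yields the next two coefficients. *)
Lemma jacobi_coef_rec n a b k : -1 < b -> (k <= n)%N ->
  jacobi_coef n a b k * ((k%:R - n%:R) * (n%:R + a + b + 1 + k%:R)) =
  jacobi_coef n a b k.+1 * (2 * k.+1%:R * (b + 1 + k%:R)).
Proof.
move=> b1 kn; rewrite /jacobi_coef !rfactSr.
have b0 : 0 < b + 1 by lra.
have h1 := rfact_neq0 (b + 1) k b0.
have h2 : b + 1 + k%:R != 0 by rewrite gt_eqF // ltr_pwDl.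
have e : (k.+1%:R * 'C(n, k.+1)%:R : R) = (n%:R - k%:R) * 'C(n, k)%:R.
  by rewrite -natrB // -!natrM mul_bin_left.
rewrite !exprS.
have h3 : (2 ^+ k : R) != 0 by rewrite expf_neq0 // pnatr_eq0.
transitivity (- ((-1) ^+ k * rfact (n%:R + a + b + 1) k / (2 ^+ k * rfact (b + 1) k)
   * (n%:R + a + b + 1 + k%:R) * (k.+1%:R * 'C(n, k.+1)%:R))).
  by rewrite e; field; rewrite h1 h3.
by field; rewrite h1 h3 h2.
Qed.

Lemma jacobi_shift_gt0 n a b : 0 < a -> -1 < b -> 0 < n%:R + a + b + 1.
Proof. by move=> a0 b1; have : (0 : R) <= n%:R by []; lra. Qed.

Lemma coef_jacobi_poly_lead n a b : 0 < a -> -1 < b -> (jacobi_poly n a b)`_n = 1.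
Proof.
move=> a0 b1; rewrite coef_jacobi_poly /jacobi_scale /jacobi_coef binn.
have b0 : 0 < b + 1 by lra.
have h1 := rfact_neq0 (b + 1) n b0.
have h2 := rfact_neq0 _ n (jacobi_shift_gt0 n a b a0 b1).
have h3 : (2 ^+ n : R) != 0 by rewrite expf_neq0 // pnatr_eq0.
have -> : (-2 : R) = (-1) * 2 by ring.
rewrite exprMn.
have e : ((-1) ^+ n * (-1) ^+ n : R) = 1 by rewrite -expr2 sqrr_sign.
transitivity (((-1) ^+ n * (-1) ^+ n : R)) => //.
by field; rewrite h1 h2 h3.
Qed.

Lemma coef_jacobi_poly1 n a b : 0 < a -> -1 < b ->
  (jacobi_poly n.+1 a b)`_n =
    - (2 * n.+1%:R * (n.+1%:R + b) / (2 * n.+1%:R + a + b)).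
Proof.
move=> a0 b1; have := coef_jacobi_poly_lead n.+1 a b a0 b1.
have := jacobi_coef_rec n.+1 a b n b1 (leqnSn n).
rewrite !coef_jacobi_poly.
move: (jacobi_scale n.+1 a b) (jacobi_coef n.+1 a b n.+1) (jacobi_coef n.+1 a b n) => s c1
    c0.
move=> e1 e2; have n0 : (0 : R) <= n%:R by [].
have h : 2 * n.+1%:R + a + b != 0 by rewrite gt_eqF // -natr1; lra.
apply: (mulIf h); rewrite mulNr divfK //.
transitivity (- (s * (c0 * ((n%:R - n.+1%:R) * (n.+1%:R + a + b + 1 + n%:R))))).
  by rewrite -natr1; ring.
rewrite e1.
transitivity (- ((s * c1) * (2 * n.+1%:R * (b + 1 + n%:R)))); first by ring.
by rewrite e2 -natr1; ring.
Qed.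

Lemma coef_jacobi_poly2 n a b : 0 < a -> -1 < b ->
  (jacobi_poly n.+2 a b)`_n =
    2 * n.+2%:R * (n.+2%:R + b) / (2 * n.+2%:R + a + b) *
    (n.+1%:R * (n.+1%:R + b) / (2 * n.+1%:R + 1 + a + b)).
Proof.
move=> a0 b1; have := coef_jacobi_poly1 n.+1 a b a0 b1.
have := jacobi_coef_rec n.+2 a b n b1 (leq_trans (leqnSn n) (leqnSn _)).
rewrite !coef_jacobi_poly.
move: (jacobi_scale n.+2 a b) (jacobi_coef n.+2 a b n.+1) (jacobi_coef n.+2 a b n) => s c1
    c0.
move=> e1 e2; have n0 : (0 : R) <= n%:R by [].
have E1 : n.+1%:R = n%:R + 1 :> R by rewrite -natr1.
have E2 : n.+2%:R = n%:R + 2 :> R by rewrite -addn2 natrD.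
have h : 2 * (2 * n.+1%:R + 1 + a + b) != 0 by rewrite E1 gt_eqF //; lra.
apply: (mulIf h).
transitivity (- (s * (c0 * ((n%:R - n.+2%:R) * (n.+2%:R + a + b + 1 + n%:R))))).
  by rewrite E1 E2; ring.
rewrite e1.
transitivity (- ((s * c1) * (2 * n.+1%:R * (b + 1 + n%:R)))); first by ring.
rewrite e2 E1 E2; field.
by apply/andP; split; rewrite gt_eqF //; lra.
Qed.

(** At z = 2 the hypergeometric argument z / 2 is 1, where the Chu-Vandermonde sum applies. *)
Lemma horner_jacobi_poly n a b : 0 < a -> -1 < b ->
  (jacobi_poly n a b).[2] = 2 ^+ n * rfact (a + 1) n / rfact (n%:R + a + b + 1) n.
Proof.
move=> a0 b1; have b0 : 0 < b + 1 by lra.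
rewrite (@horner_coef_wide _ n.+1) ?size_poly //.
under eq_bigr => k _ do rewrite coef_jacobi_poly.
have -> : \sum_(i < n.+1) jacobi_scale n a b * jacobi_coef n a b i * 2 ^+ i =
  jacobi_scale n a b * \sum_(k < n.+1) (-1) ^+ k * 'C(n, k)%:R *
    (rfact (n%:R + a + b + 1) k / rfact (b + 1) k).
  rewrite mulr_sumr; apply: eq_bigr => k _; rewrite /jacobi_coef.
  have h3 : (2 ^+ k : R) != 0 by rewrite expf_neq0 // pnatr_eq0.
  by field; rewrite h3 rfact_neq0.
rewrite chu_vandermonde // /jacobi_scale.
have -> : b + 1 - (n%:R + a + b + 1) = - a - n%:R by ring.
rewrite rfact_opp.
have -> : (-2 : R) = (-1) * 2 by ring.
rewrite exprMn.
have e : ((-1) ^+ n * (-1) ^+ n : R) = 1 by rewrite -expr2 sqrr_sign.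
transitivity (((-1) ^+ n * (-1) ^+ n) * (2 ^+ n * rfact (a + 1) n / rfact (n%:R + a + b + 1)
    n)).
  by field; rewrite !rfact_neq0 // jacobi_shift_gt0.
by rewrite e mul1r.
Qed.

Lemma jacobi_funXn a b k : -1 < a -> -1 < b ->
  jacobi_fun a b 'X^k = 2 ^+ k * rfact (b + 1) k / rfact (a + b + 2) k * jacobi_int a b.
Proof.
move=> a1; elim: k b => [|k IHk] b b1.
  by rewrite expr0 jacobi_fun1 !rfact0 mulr1 divr1 mul1r.
have b2 : -1 < b + 1 by lra.
rewrite exprS jacobi_funMr IHk // jacobi_intSr // !rfactSl.
have -> : a + (b + 1) + 2 = a + b + 2 + 1 by ring.
have h0 : a + b + 2 != 0 by rewrite gt_eqF //; lra.
have h : 0 < a + b + 2 + 1 by lra.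
have h1 := rfact_neq0 (a + b + 2 + 1) k h.
by rewrite exprS; field; rewrite h1 h0.
Qed.

Lemma jacobi_fun0 a b : -1 < a -> -1 < b -> jacobi_fun a b 0 = 0 :> R.
Proof. by move=> a1 b1; rewrite -(scale0r 0) jacobi_funZ // mul0r. Qed.

Lemma jacobi_fun_sum a b n (F : nat -> {poly R}) : -1 < a -> -1 < b ->
  jacobi_fun a b (\sum_(i < n) F i) = \sum_(i < n) jacobi_fun a b (F i).
Proof.
move=> a1 b1; elim: n => [|n IHn]; first by rewrite !big_ord0 jacobi_fun0.
by rewrite !big_ord_recr /= jacobi_funD // IHn.
Qed.

(* c = a + j gives the pairing with (1 - x)^j, which vanishes for j < n; c = a - 1 gives the
   moment that couples the two components of a row. *)
Lemma jacobi_fun_jacobi_poly c n a b : -1 < c -> 0 < a -> -1 < b ->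
  jacobi_fun c b (jacobi_poly n a b) =
  jacobi_scale n a b * (rfact (c - a + 1 - n%:R) n / rfact (c + b + 2) n) * jacobi_int c b.
Proof.
move=> c1 a0 b1; have b0 : 0 < b + 1 by lra.
have cb : 0 < c + b + 2 by lra.
rewrite /jacobi_poly poly_def.
rewrite (@jacobi_fun_sum _ _ _ (fun i => (jacobi_scale n a b * jacobi_coef n a b i) *:
    'X^i)) //.
have -> : c - a + 1 - n%:R = c + b + 2 - (n%:R + a + b + 1) by ring.
rewrite -chu_vandermonde // -mulrA mulr_suml mulr_sumr; apply: eq_bigr => k _.
rewrite jacobi_funZ // jacobi_funXn // /jacobi_coef.
have h3 : (2 ^+ k : R) != 0 by rewrite expf_neq0 // pnatr_eq0.
by field; rewrite h3 !rfact_neq0.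
Qed.

Lemma jacobi_fun_expl a b j q :
  jacobi_fun a b ((2%:P - 'X) ^+ j * q) = jacobi_fun (a + j%:R) b q.
Proof.
elim: j a => [|j IHj] a; first by rewrite expr0 mul1r addr0.
by rewrite exprS -mulrA jacobi_funMl IHj -addrA nat1r.
Qed.

Lemma size_flip : size (2%:P - 'X : {poly R}) = 2%N.
Proof.
by rewrite -size_polyN opprB size_XsubC.
Qed.

(** Substituting 2 - z is an involution. Powers of 2 - z = 1 - x are a convenient basis because each
    factor only raises the first exponent of the weight. *)
Lemma poly_flip_sum q m : (size q <= m)%N ->
  exists c : nat -> R, q = \sum_(i < m) c i *: (2%:P - 'X) ^+ i.
Proof.
move=> qm; pose r := q \Po (2%:P - 'X); exists (fun i => r`_i).
have -> : q = r \Po (2%:P - 'X).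
  rewrite /r -comp_polyA comp_polyB comp_polyC comp_polyX.
  by rewrite opprB addrCA subrr addr0 comp_polyXr.
rewrite comp_polyE; have rs : (size r <= m)%N by rewrite size_comp_poly2 // size_flip.
rewrite (big_ord_widen _ (fun i => r`_i *: (2%:P - 'X) ^+ i) rs).
rewrite [RHS](bigID (fun i : 'I_m => (i < size r)%N)) /= [X in _ = _ + X]big1 ?addr0.
  by [].
by move=> i; rewrite -leqNgt => h; rewrite nth_default ?scale0r.
Qed.

Lemma jacobi_orth n a b q : 0 < a -> -1 < b -> (size q <= n)%N ->
  jacobi_fun a b (jacobi_poly n a b * q) = 0.
Proof.
move=> a0 b1 /poly_flip_sum [c ->].
have a1 : -1 < a by lra.
rewrite mulr_sumr.
rewrite (@jacobi_fun_sum _ _ _ (fun i => jacobi_poly n a b * (c i *: (2%:P - 'X) ^+ i))) //.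
rewrite big1 // => i _; rewrite -scalerAr jacobi_funZ // mulrC.
rewrite [jacobi_poly _ _ _ * _]mulrC jacobi_fun_expl jacobi_fun_jacobi_poly //; last first.
  by have : (0 : R) <= i%:R by []; lra.
have -> : a + i%:R - a + 1 - n%:R = i.+1%:R - n%:R by rewrite -natr1; ring.
by rewrite rfact_eq0 // !(mul0r, mulr0).
Qed.

Lemma jacobi_norm_neq0 n a b : 0 < a -> -1 < b ->
  jacobi_fun a b (jacobi_poly n a b * (2%:P - 'X) ^+ n) != 0.
Proof.
move=> a0 b1; have n0 : (0 : R) <= n%:R by [].
have an : -1 < a + n%:R by lra.
rewrite mulrC jacobi_fun_expl jacobi_fun_jacobi_poly //.
have -> : a + n%:R - a + 1 - n%:R = 1 by ring.
have b0 : 0 < b + 1 by lra.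
have h : 0 < a + n%:R + b + 2 by lra.
rewrite !mulf_neq0 ?invr_eq0 ?rfact_neq0 ?jacobi_shift_gt0 ?expf_neq0 ?oppr_eq0 ?pnatr_eq0
    //.
by rewrite gt_eqF // jacobi_int_gt0.
Qed.

Lemma size_sub_lead (q r : {poly R}) n : (size q <= n.+1)%N -> (size r <= n.+1)%N ->
  r`_n = 1 -> (size (q - q`_n *: r)%R <= n)%N.
Proof.
move=> qn rn r1; apply/leq_sizeP => j; rewrite leq_eqVlt => /orP[/eqP<-|h].
  by rewrite coefB coefZ r1 mulr1 subrr.
rewrite coefB coefZ (nth_default _ (leq_trans qn h)) (nth_default _ (leq_trans rn h)).
by rewrite mulr0 subr0.
Qed.

(** Pairing q with the Jacobi polynomial of its own degree isolates the leading coefficient: the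
    part of lower degree is killed by orthogonality, and the rest is that coefficient times a
    nonzero norm. *)
Lemma jacobi_nondegenerate a b m q : 0 < a -> -1 < b -> (size q <= m)%N ->
  (forall r, (size r <= m)%N -> jacobi_fun a b (q * r) = 0) -> q = 0.
Proof.
move=> a0 b1 qm orth; apply/eqP; apply/negP => /negP q0.
have a1 : -1 < a by lra.
have sq : size q = (size q).-1.+1 by rewrite prednK // size_poly_gt0.
set d := (size q).-1 in sq.
have dm : (d.+1 <= m)%N by rewrite -sq.
pose y := (2%:P - 'X : {poly R}) ^+ d.
have yE : y = (-1) ^+ d *: ('X - 2%:P) ^+ d by rewrite -exprZn scaleN1r opprB.
have y1 : (-1) ^+ d * y`_d = 1.
  rewrite yE coefZ mulrA -expr2 sqrr_sign mul1r.
  have := monic_exp d (monicXsubC (2 : R)) => /monicP.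
  by rewrite /lead_coef size_exp_XsubC.
have sy : (size ((-1) ^+ d *: y)%R <= d.+1)%N.
  apply: (leq_trans (size_scale_leq _ _)); rewrite yE.
  by apply: (leq_trans (size_scale_leq _ _)); rewrite size_exp_XsubC.
have hs : (size (q - q`_d *: ((-1) ^+ d *: y))%R <= d)%N.
  by apply: size_sub_lead; rewrite ?sq // coefZ.
have := orth (jacobi_poly d a b) (leq_trans (size_jacobi_poly _ _ _) dm).
rewrite -[q](subrK (q`_d *: ((-1) ^+ d *: y))) mulrC mulrDr jacobi_funD //.
rewrite jacobi_orth // add0r scalerA -scalerAr jacobi_funZ // => /eqP.
rewrite mulf_eq0 (negbTE (jacobi_norm_neq0 d a b a0 b1)) orbF.
rewrite mulf_eq0 signr_eq0 orbF => /eqP lc.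
by move: q0; rewrite -lead_coef_eq0 /lead_coef -/d lc eqxx.
Qed.

(** After the two top Jacobi components are subtracted, the remainder has degree below n and is
    still orthogonal to all such polynomials, hence zero. *)
Lemma jacobi_two_terms n a b q : 0 < a -> -1 < b -> (size q <= n.+2)%N ->
  (forall r, (size r <= n)%N -> jacobi_fun a b (q * r) = 0) ->
  exists e : R, q = q`_n.+1 *: jacobi_poly n.+1 a b + e *: jacobi_poly n a b.
Proof.
move=> a0 b1 qn orth.
have a1 : -1 < a by lra.
pose q1 := q - q`_n.+1 *: jacobi_poly n.+1 a b.
have s1 : (size q1 <= n.+1)%N.
  by apply: size_sub_lead; rewrite ?size_jacobi_poly ?coef_jacobi_poly_lead.
exists q1`_n.
have s2 : (size (q1 - q1`_n *: jacobi_poly n a b)%R <= n)%N.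
  by apply: size_sub_lead; rewrite ?size_jacobi_poly ?coef_jacobi_poly_lead.
suff : q1 - q1`_n *: jacobi_poly n a b = 0.
  by move/eqP; rewrite subr_eq0 => /eqP <-; rewrite /q1 addrC subrK.
apply: (@jacobi_nondegenerate a b n) => // r rn.
rewrite mulrBl -scaleN1r jacobi_funD // jacobi_funZ // -scalerAl jacobi_funZ //.
rewrite jacobi_orth // !mulr0 addr0 /q1.
rewrite mulrBl -scaleN1r jacobi_funD // jacobi_funZ // -scalerAl jacobi_funZ //.
by rewrite orth // jacobi_orth ?(leq_trans rn) // !mulr0 addr0.
Qed.

End JacobiPolynomial.

(** * The linear system for the two unknowns of a row *)

Section RowSystem.
Context {R : realType}.
Implicit Types (a b al be p t s u v : R) (n m k : nat).

(** The closed form at c = a - 1, where the numerator symbol (-k)_k is a signed factorial. *)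
Lemma jacobi_moment k a b : 0 < a -> -1 < b ->
  jacobi_fun (a - 1) b (jacobi_poly k a b) =
  2 ^+ k * rfact 1 k * rfact (b + 1) k /
    (rfact (k%:R + a + b + 1) k * rfact (a + b + 1) k) * jacobi_int (a - 1) b.
Proof.
move=> a0 b1; have b0 : 0 < b + 1 by lra.
have a1 : -1 < a - 1 by lra.
have ab : 0 < a + b + 1 by lra.
rewrite jacobi_fun_jacobi_poly // /jacobi_scale.
have -> : a - 1 - a + 1 - k%:R = - 0 - k%:R by ring.
rewrite rfact_opp add0r.
have -> : a - 1 + b + 2 = a + b + 1 by ring.
have -> : (-2 : R) = (-1) * 2 by ring.
rewrite exprMn.
have e : ((-1) ^+ k * (-1) ^+ k : R) = 1 by rewrite -expr2 sqrr_sign.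
transitivity (((-1) ^+ k * (-1) ^+ k) * (2 ^+ k * rfact 1 k * rfact (b + 1) k /
    (rfact (k%:R + a + b + 1) k * rfact (a + b + 1) k) * jacobi_int (a - 1) b)).
  by field; rewrite !rfact_neq0 // jacobi_shift_gt0.
by rewrite e mul1r.
Qed.

(** Here n = m + 1 is the degree of the matrix polynomial. The first equation is the constraint at z
    = 2, the second the moment condition from the test row (1, 0), each divided by a nonzero common
    factor. *)
Lemma row_system al be p m t s u v (a f : {poly R}) :
  -1 < al -> -1 < be ->
  a = t *: jacobi_poly m.+1 (al + 1) (be + 1) + v *: jacobi_poly m (al + 1) (be + 1) ->
  f = s *: jacobi_poly m.+2 (al + 1) be + u *: jacobi_poly m.+1 (al + 1) be ->
  f.[2] = 2 * a.[2] ->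
  jacobi_fun al be f + p * jacobi_fun al (be + 1) a = 0 ->
  let n := m%:R + 1 in let N := 2 * n + al + be + 1 in
  u * (n + al + 1) / N - v =
    2 * t * (n + al + 1) * (n + al + be + 2) / (N * (N + 1))
    - 2 * s * (n + al + 1) * (n + al + 2) * (n + al + be + 2) / (N * (N + 1) * (N + 2)) /\
  u * n / N + p * v =
    - (2 * s * n * (n + 1) * (n + be + 1) / (N * (N + 1) * (N + 2)))
    - 2 * p * t * n * (n + be + 1) / (N * (N + 1)).
Proof.
move=> al1 be1 aE fE f2 mom n N.
have m0 : (0 : R) <= m%:R by [].
have E1 : m.+1%:R = n by rewrite -natr1.
have E2 : m.+2%:R = n + 1 by rewrite -natr1 E1.
(* The denominators of the values and moments contain symbols starting at [c] or [c + 1]; the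
   relations below write each as a multiple of the one of length m starting at [c + 1]. *)
pose c := n + al + be + 2.
have c0 : 0 < c by rewrite /c /n; lra.
have c1 : 0 < c + 1 by lra.
have a0 : 0 < al + 1 by lra.
have a2 : 0 < al + 2 by lra.
have b1 : -1 < be + 1 by lra.
have b0 : 0 < be + 1 by lra.
have ab : 0 < al + be + 2 by lra.
have ab1 : 0 < al + be + 2 + 1 by lra.
have abn : 0 < al + be + 2 + m%:R by lra.
have abn1 : 0 < al + be + 2 + m%:R + 1 by lra.
have N0 : 0 < N by rewrite /N /n; lra.
have N1 : 0 < N + 1 by lra.
have N2 : 0 < N + 2 by lra.
have cm : c + m%:R = N by rewrite /c /N /n; ring.
have D0 : rfact (c + 1) m != 0 by rewrite rfact_neq0.
have rc : rfact c m = c * rfact (c + 1) m / N.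
  by rewrite -rfactSl rfactSr cm mulfK // gt_eqF.
have rc1 : rfact c m.+1 = c * rfact (c + 1) m by rewrite rfactSl.
have rc11 : rfact (c + 1) m.+1 = rfact (c + 1) m * (N + 1).
  by rewrite rfactSr -cm; congr (_ * _); ring.
have rc12 : rfact (c + 1) m.+2 = rfact (c + 1) m * (N + 1) * (N + 2).
  by rewrite rfactSr rc11 -cm E1 /n; congr (_ * _); ring.
have p2 : (2 ^+ m : R) != 0 by rewrite expf_neq0 // pnatr_eq0.
have al2 : al + 1 + 1 = al + 2 by ring.
have s1 : m%:R + (al + 1) + (be + 1) + 1 = c by rewrite /c /n; ring.
have s2 : m.+1%:R + (al + 1) + (be + 1) + 1 = c + 1 by rewrite E1 /c /n; ring.
have s3 : m.+1%:R + (al + 1) + be + 1 = c by rewrite E1 /c /n; ring.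
have s4 : m.+2%:R + (al + 1) + be + 1 = c + 1 by rewrite E2 /c /n; ring.
split.
  move: f2; rewrite aE fE !(hornerD, hornerZ) !horner_jacobi_poly // al2 s1 s2 s3 s4.
  rewrite rc rc1 rc11 rc12.
  have A0 := rfact_neq0 (al + 2) m a2.
  have -> : rfact (al + 2) m.+2 = rfact (al + 2) m * (n + al + 1) * (n + al + 2).
    by rewrite !rfactSr E1 /n; ring.
  have -> : rfact (al + 2) m.+1 = rfact (al + 2) m * (n + al + 1).
    by rewrite rfactSr /n; ring.
  rewrite !exprS.
  move: (rfact (c + 1) m) (rfact (al + 2) m) (2 ^+ m) D0 A0 p2 => D A P D0 A0 P0 e.
  have cn0 : c != 0 by rewrite gt_eqF.
  have n0 : N != 0 by rewrite gt_eqF.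
  have n1 : N + 1 != 0 by rewrite gt_eqF.
  have n2 : N + 2 != 0 by rewrite gt_eqF.
  (* With all symbols reduced to length m, the constraint is this factor times the claimed
     equation. *)
  have K0 : 2 * P * A * N / (c * D) != 0.
    by rewrite !mulf_neq0 ?invr_eq0 ?mulf_neq0 ?pnatr_eq0.
  apply: (mulIf K0).
  transitivity ((s * (2 * (2 * P) * (A * (n + al + 1) * (n + al + 2)) / (D * (N + 1) * (N +
      2))) +
    u * (2 * P * (A * (n + al + 1)) / (c * D))) -
     s * (2 * (2 * P) * (A * (n + al + 1) * (n + al + 2)) / (D * (N + 1) * (N + 2)))
     - 2 * v * (P * A / (c * D / N))).
    by field; rewrite D0 n0 n1 n2 cn0.
  rewrite e -/c; clearbody N c n; field; by rewrite D0 n0 n1 n2 cn0.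
move: mom; rewrite aE fE !jacobi_funD // !jacobi_funZ //; [|lra..].
have momE k b : -1 < b -> jacobi_fun al b (jacobi_poly k (al + 1) b) =
    2 ^+ k * rfact 1 k * rfact (b + 1) k /
    (rfact (k%:R + (al + 1) + b + 1) k * rfact (al + 1 + b + 1) k) * jacobi_int al b.
  by move=> hb; have := jacobi_moment k (al + 1) b a0 hb; rewrite addrK.
rewrite !momE // jacobi_intSr // {momE}.
rewrite s1 s2 s3 s4 rc rc1 rc11 rc12.
have -> : al + 1 + be + 1 = al + be + 2 by ring.
have -> : al + 1 + (be + 1) + 1 = al + be + 2 + 1 by ring.
have -> : be + 1 + 1 = be + 2 by ring.
have b2 : 0 < be + 2 by lra.
have -> : rfact (be + 1) m.+2 = (be + 1) * rfact (be + 2) m * (n + be + 1).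
  rewrite rfactSl rfactSr; have -> : be + 1 + 1 = be + 2 by ring.
  by rewrite /n; ring.
have -> : rfact (be + 1) m.+1 = (be + 1) * rfact (be + 2) m.
  by rewrite rfactSl; have -> : be + 1 + 1 = be + 2 by ring.
have -> : rfact (be + 2) m.+1 = rfact (be + 2) m * (n + be + 1).
  by rewrite rfactSr /n; ring.
have -> : rfact (al + be + 2) m.+2 = (al + be + 2) * rfact (al + be + 2 + 1) m * c.
  by rewrite rfactSl rfactSr /c /n; ring.
have -> : rfact (al + be + 2) m.+1 = (al + be + 2) * rfact (al + be + 2 + 1) m.
  by rewrite rfactSl.
have -> : rfact (al + be + 2 + 1) m.+1 = rfact (al + be + 2 + 1) m * c.
  by rewrite rfactSr /c /n; ring.
have -> : rfact 1 m.+2 = rfact 1 m * n * (n + 1) :> R.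
  by rewrite !rfactSr E1 /n; ring.
have -> : rfact 1 m.+1 = rfact 1 m * n :> R by rewrite rfactSr /n; ring.
rewrite !exprS.
have F0 := rfact_neq0 (1 : R) m ltr01.
have B0 := rfact_neq0 (be + 2) m b2.
have G0 := rfact_neq0 _ m ab1.
have I0 : jacobi_int al be != 0 by rewrite gt_eqF // jacobi_int_gt0.
move: (rfact (c + 1) m) (rfact 1 m) (rfact (be + 2) m) (rfact (al + be + 2 + 1) m)
  (jacobi_int al be) (2 ^+ m) D0 F0 B0 G0 I0 p2 => D F B G I P D0 F0 B0 G0 I0 P0 e.
have cn0 : c != 0 by rewrite gt_eqF.
have n0 : N != 0 by rewrite gt_eqF.
have n1 : N + 1 != 0 by rewrite gt_eqF.
have n2 : N + 2 != 0 by rewrite gt_eqF.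
have ab0 : al + be + 2 != 0 by rewrite gt_eqF.
have bn0 : be + 1 != 0 by rewrite gt_eqF.
have K0 : 2 * P * F * B * I * (be + 1) * N / ((al + be + 2) * c * D * G) != 0.
  by rewrite !mulf_neq0 ?invr_eq0 ?mulf_neq0 ?pnatr_eq0.
apply: (mulIf K0).
apply: subr0_eq; rewrite -[RHS]e.
rewrite -/c; clearbody N c n; field; by rewrite D0 n0 n1 n2 cn0 G0 ab0.
Qed.

End RowSystem.

(** * Asymptotic expansions in powers of 1 / n *)

Section Expansions.
Context {R : realType}.
Implicit Types (f g r : nat -> R) (n : nat) (c d k : R).

Definition invn n : R := n%:R^-1.

Definition ev_bounded f := exists K : R, exists N0 : nat,
  forall n, (N0 <= n)%N -> `|f n| <= K.

Lemma ev_bounded_cst c : ev_bounded (fun=> c).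
Proof. by exists `|c|, 0%N. Qed.

Lemma ev_boundedD f g : ev_bounded f -> ev_bounded g -> ev_bounded (fun n => f n + g n).
Proof.
move=> [K [N0 HK]] [L [N1 HL]]; exists (K + L), (maxn N0 N1) => n.
rewrite geq_max => /andP[h0 h1].
by rewrite (le_trans (ler_normD _ _)) // lerD ?HK ?HL.
Qed.

Lemma ev_boundedM f g : ev_bounded f -> ev_bounded g -> ev_bounded (fun n => f n * g n).
Proof.
move=> [K [N0 HK]] [L [N1 HL]]; exists (K * L), (maxn N0 N1) => n.
rewrite geq_max => /andP[h0 h1].
by rewrite normrM ler_pM ?HK ?HL.
Qed.

Lemma ev_boundedN f : ev_bounded f -> ev_bounded (fun n => - f n).
Proof. by move=> [K [N0 HK]]; exists K, N0 => n h; rewrite normrN HK. Qed.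

Lemma ev_boundedX f m : ev_bounded f -> ev_bounded (fun n => f n ^+ m).
Proof.
move=> Hf; elim: m => [|m IHm]; first exact: ev_bounded_cst.
have [K [N0 HK]] := ev_boundedM _ _ Hf IHm.
by exists K, N0 => n h; rewrite exprS HK.
Qed.

Lemma ev_bounded_shift f : ev_bounded f -> ev_bounded (fun n => f n.+1).
Proof. by move=> [K [N0 HK]]; exists K, N0 => n h; rewrite HK // leqW. Qed.

Lemma invn_ge0 n : 0 <= invn n.
Proof. by rewrite invr_ge0. Qed.

Lemma mul_natr_invn n : (0 < n)%N -> n%:R * invn n = 1.
Proof. by move=> n0; rewrite mulfV // pnatr_eq0 -lt0n. Qed.

Lemma ev_bounded_invn : ev_bounded invn.
Proof.
exists 1, 1%N => n n0; rewrite ger0_norm ?invn_ge0 //.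
by rewrite invf_le1 ?ler1n ?ltr0n.
Qed.

Ltac ev_bounded_tac := repeat first
  [ assumption | exact ev_bounded_invn | exact (ev_bounded_shift _ ev_bounded_invn) | apply:
      ev_bounded_cst
  | apply: ev_boundedD | apply: ev_boundedN | apply: ev_boundedM | apply: ev_boundedX ].

(* f n = c0 + c1 / n + c2 / n^2 + c3 / n^3 + O(n^-4) *)
Definition expansion f c0 c1 c2 c3 := exists2 r, ev_bounded r &
  exists N0, forall n, (N0 <= n)%N ->
    f n = c0 + c1 * invn n + c2 * invn n ^+ 2 + c3 * invn n ^+ 3 + r n * invn n ^+ 4.

Lemma expansion_cst c : expansion (fun=> c) c 0 0 0.
Proof.
exists (fun=> 0); first exact: ev_bounded_cst.
by exists 0%N => n _; ring.
Qed.

Lemma expansion_invn : expansion invn 0 1 0 0.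
Proof.
exists (fun=> 0); first exact: ev_bounded_cst.
by exists 0%N => n _; ring.
Qed.

Lemma expansionD f g c0 c1 c2 c3 d0 d1 d2 d3 :
  expansion f c0 c1 c2 c3 -> expansion g d0 d1 d2 d3 ->
  expansion (fun n => f n + g n) (c0 + d0) (c1 + d1) (c2 + d2) (c3 + d3).
Proof.
move=> [r br [N0 Hf]] [s bs [N1 Hg]]; exists (fun n => r n + s n); first by ev_bounded_tac.
exists (maxn N0 N1) => n; rewrite geq_max => /andP[h0 h1].
by rewrite Hf // Hg //; ring.
Qed.

Lemma expansionM f g c0 c1 c2 c3 d0 d1 d2 d3 :
  expansion f c0 c1 c2 c3 -> expansion g d0 d1 d2 d3 ->
  expansion (fun n => f n * g n) (c0 * d0) (c0 * d1 + c1 * d0)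
    (c0 * d2 + c1 * d1 + c2 * d0) (c0 * d3 + c1 * d2 + c2 * d1 + c3 * d0).
Proof.
move=> [r br [N0 Hf]] [s bs [N1 Hg]].
exists (fun n => c1 * d3 + c2 * d2 + c3 * d1 + (c2 * d3 + c3 * d2) * invn n
  + c3 * d3 * invn n ^+ 2
  + (c0 + c1 * invn n + c2 * invn n ^+ 2 + c3 * invn n ^+ 3) * s n
  + (d0 + d1 * invn n + d2 * invn n ^+ 2 + d3 * invn n ^+ 3) * r n
  + r n * s n * invn n ^+ 4); first by ev_bounded_tac.
exists (maxn N0 N1) => n; rewrite geq_max => /andP[h0 h1].
by rewrite Hf // Hg //; ring.
Qed.

Lemma expansion_eq f g c0 c1 c2 c3 d0 d1 d2 d3 : expansion f c0 c1 c2 c3 ->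
  (exists N0, forall n, (N0 <= n)%N -> f n = g n) ->
  c0 = d0 -> c1 = d1 -> c2 = d2 -> c3 = d3 -> expansion g d0 d1 d2 d3.
Proof.
move=> [r br [N0 Hf]] [N1 fg] <- <- <- <-; exists r => //; exists (maxn N0 N1) => n.
by rewrite geq_max => /andP[h0 h1]; rewrite -fg // Hf.
Qed.

Lemma lin_eventually_ge k d : 0 < k ->
  exists N0, forall n, (N0 <= n)%N -> k / 2 * n%:R <= k * n%:R + d.
Proof.
move=> k0; pose M := Num.bound (2 * `|d| / k).
have k1 : 0 <= k^-1 by rewrite invr_ge0 ltW.
exists M => n hn.
have : 2 * `|d| / k <= n%:R.
  apply: (@le_trans _ _ M%:R); last by rewrite ler_nat.
  by rewrite ltW // archi_boundP // !mulr_ge0.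
rewrite ler_pdivrMr // => h.
have : - `|d| <= d by rewrite lerNl -normrN ler_norm.
lra.
Qed.

(** The geometric series of 1 / (k + d / n): after four terms the remainder is exactly (d / (k n))^4
    times the function itself, which is eventually at most 2 / k. *)
Lemma expansion_inv_lin k d : 0 < k ->
  expansion (fun n => n%:R / (k * n%:R + d))
    (k^-1) (- d / k ^+ 2) (d ^+ 2 / k ^+ 3) (- d ^+ 3 / k ^+ 4).
Proof.
move=> k0; have [N0 HN] := lin_eventually_ge _ d k0.
have kn0 : k != 0 by rewrite gt_eqF.
exists (fun n => d ^+ 4 / k ^+ 4 * (n%:R / (k * n%:R + d))).
  apply: ev_boundedM; first exact: ev_bounded_cst.
  exists (2 / k), (maxn 1 N0) => n; rewrite geq_max => /andP[n0 hn].
  have h := HN n hn; have np : (0 : R) < n%:R by rewrite ltr0n.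
  have q0 : 0 < k / 2 * n%:R by rewrite !mulr_gt0.
  have q1 : 0 < k * n%:R + d by exact: lt_le_trans h.
  rewrite ger0_norm; last by rewrite divr_ge0 // ltW.
  rewrite ler_pdivrMr // mulrAC ler_pdivlMr //.
  lra.
exists (maxn 1 N0) => n; rewrite geq_max => /andP[n0 hn].
have h := HN n hn; have np : (0 : R) < n%:R by rewrite ltr0n.
have q0 : 0 < k / 2 * n%:R by rewrite !mulr_gt0.
have q1 : k * n%:R + d != 0 by rewrite gt_eqF //; exact: lt_le_trans h.
rewrite /invn; field.
by rewrite q1 kn0 gt_eqF.
Qed.

Lemma expansion_lin k d : expansion (fun n => (k * n%:R + d) * invn n) k d 0 0.
Proof.
apply: (expansion_eq (fun n => k + d * invn n)).
- exact: expansionD (expansion_cst k) (expansionM _ _ _ _ _ _ _ _ _ _ (expansion_cst d)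
    expansion_invn).
- by exists 1%N => n n0; rewrite mulrDl -mulrA mul_natr_invn // mulr1.
all: ring.
Qed.

(** Turns powers of 1 / (n + 1) into bounded multiples of powers of 1 / n. *)
Definition succ_ratio n : R := n%:R / n.+1%:R.

Lemma ev_bounded_succ_ratio : ev_bounded succ_ratio.
Proof.
exists 1, 0%N => n _.
by rewrite ger0_norm ?divr_ge0 // ler_pdivrMr ?ltr0n // mul1r ler_nat.
Qed.

(** The constant c1 drops out, and c2 (1 / n - 1 / (n + 1)) supplies the term in 1 / n^2. For a
    subleading coefficient, -c0 is the identity entry added to B_n and c2 the entry of [B2]. *)
Lemma expansion_diff1 (X : nat -> R) c0 c1 c2 c3 :
  expansion (fun n => X n * invn n) c0 c1 c2 c3 ->
  exists2 r, ev_bounded r & exists N0, forall n, (N0 <= n)%N ->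
    X n - X n.+1 = - c0 + c2 * invn n ^+ 2 + r n * invn n ^+ 3.
Proof.
move=> [r br [N0 HX]].
have brs := ev_bounded_shift _ br; have bq := ev_bounded_succ_ratio.
exists (fun n => - c2 * succ_ratio n + c3 * succ_ratio n * (1 + succ_ratio n) + r n - r n.+1
    * succ_ratio n ^+ 3).
  by ev_bounded_tac.
exists (maxn 1 N0) => n; rewrite geq_max => /andP[n0 hn].
have np : (0 : R) < n%:R by rewrite ltr0n.
have np1 : (0 : R) < n%:R + 1 by lra.
have XE m : (0 < m)%N -> (N0 <= m)%N -> X m = c0 * m%:R + c1 + c2 * invn m + c3 * invn m ^+
    2 + r m * invn m ^+ 3.
  move=> m0 hm; have mp : m%:R != 0 :> R by rewrite gt_eqF // ltr0n.
  rewrite -[LHS]mulr1 -(mul_natr_invn m m0) mulrA mulrAC HX // /invn; field.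
  by rewrite mp.
rewrite !XE // ?leqW // /succ_ratio /invn -natr1; field.
by rewrite !gt_eqF.
Qed.

(** Here c2 is the constant term of Y and differences away, while c3 contributes to the
    remainder. *)
Lemma expansion_diff2 (Y : nat -> R) c0 c1 c2 c3 :
  expansion (fun n => Y n * invn n ^+ 2) c0 c1 c2 c3 ->
  exists2 r, ev_bounded r & exists N0, forall n, (N0 <= n)%N ->
    Y n - Y n.+1 = - (2 * n%:R + 1) * c0 - c1 + r n * invn n ^+ 2.
Proof.
move=> [r br [N0 HY]].
have brs := ev_bounded_shift _ br; have bq := ev_bounded_succ_ratio.
exists (fun n => c3 * succ_ratio n + r n - r n.+1 * succ_ratio n ^+ 2).
  by ev_bounded_tac.
exists (maxn 1 N0) => n; rewrite geq_max => /andP[n0 hn].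
have np : (0 : R) < n%:R by rewrite ltr0n.
have np1 : (0 : R) < n%:R + 1 by lra.
have YE m : (0 < m)%N -> (N0 <= m)%N -> Y m = c0 * m%:R ^+ 2 + c1 * m%:R + c2 + c3 * invn m
    + r m * invn m ^+ 2.
  move=> m0 hm; have mp : m%:R != 0 :> R by rewrite gt_eqF // ltr0n.
  rewrite -[LHS]mulr1 -(expr1n _ 2) -(mul_natr_invn m m0) exprMn mulrA mulrAC HY // /invn;
      field.
  by rewrite mp.
rewrite !YE // ?leqW // /succ_ratio /invn -natr1; field.
by rewrite !gt_eqF.
Qed.

(** Models one entry of the product of B_n + I with X_n. The coefficient of 1 / n is d0 z0 + d1 z1 -
    y0 e0 - y1 e1, which the last hypothesis makes zero. *)
Lemma expansion_mul_sum (b0 b1 X0 X1 : nat -> R) d0 d1 y0 y1 e0 e1 x0 x1 z0 z1 t0 t1 :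
  (exists2 r, ev_bounded r & exists N0, forall n, (N0 <= n)%N ->
    b0 n = d0 + y0 * invn n ^+ 2 + r n * invn n ^+ 3) ->
  (exists2 r, ev_bounded r & exists N0, forall n, (N0 <= n)%N ->
    b1 n = d1 + y1 * invn n ^+ 2 + r n * invn n ^+ 3) ->
  expansion (fun n => X0 n * invn n) (- e0) x0 z0 t0 ->
  expansion (fun n => X1 n * invn n) (- e1) x1 z1 t1 ->
  d0 * z0 + d1 * z1 = y0 * e0 + y1 * e1 ->
  exists2 r, ev_bounded r & exists N0, forall n, (N0 <= n)%N ->
    b0 n * X0 n + b1 n * X1 n =
    - (d0 * e0 + d1 * e1) * n%:R + (d0 * x0 + d1 * x1) + r n * invn n ^+ 2.
Proof.
move=> [r0 br0 [N0 H0]] [r1 br1 [N1 H1]] [s0 bs0 [M0 G0]] [s1 bs1 [M1 G1]] comm.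
exists (fun n => (d0 * (t0 + s0 n * invn n)
    + y0 * (x0 + z0 * invn n + t0 * invn n ^+ 2 + s0 n * invn n ^+ 3)
    + r0 n * (- e0 + x0 * invn n + z0 * invn n ^+ 2 + t0 * invn n ^+ 3 + s0 n * invn n ^+
        4))
  + (d1 * (t1 + s1 n * invn n)
    + y1 * (x1 + z1 * invn n + t1 * invn n ^+ 2 + s1 n * invn n ^+ 3)
    + r1 n * (- e1 + x1 * invn n + z1 * invn n ^+ 2 + t1 * invn n ^+ 3 + s1 n * invn n ^+
        4))).
  by ev_bounded_tac.
exists (maxn 1 (maxn (maxn N0 N1) (maxn M0 M1))) => n.
rewrite !geq_max => /and3P[n0 /andP[h0 h1] /andP[g0 g1]].
have np : n%:R != 0 :> R by rewrite pnatr_eq0 -lt0n.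
have E f : f n = n%:R * (f n * invn n) by rewrite mulrCA mul_natr_invn // mulr1.
rewrite (E X0) (E X1) G0 // G1 // H0 // H1 //; apply: subr0_eq.
transitivity ((d0 * z0 + d1 * z1 - (y0 * e0 + y1 * e1)) * invn n).
  by rewrite /invn; field; rewrite np.
by rewrite comm subrr mul0r.
Qed.

End Expansions.

(** * Explicit subleading coefficients and their expansions *)

Section Coefficients.
Context {R : realType}.
Implicit Types (al be p n : R).

(* In the variable z = 1 + x put f = 2 a + (2 - z) b for a row (a, b) of P_n, and let tau_n,
   sigma_n be the monic Jacobi polynomials of parameters (al + 1, be + 1), (al + 1, be).
   Then a = t tau_n + v tau_(n-1) and f = - s sigma_(n+1) + u sigma_n, where (t, s) = (1, 0)
   for the first row and (0, 1) for the second; row_ui and row_vi are the values of u and v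
   for row i.  The numbers tauk, sigmak are the coefficients of z^(n-k) in tau_n, sigma_n;
   the suffixes pred and succ replace n by n - 1 and n + 1 in the index of the polynomial
   and in its degree. *)
Definition row_N al be n : R := 2 * n + al + be + 1.
Definition row_den al p n : R := (1 + p) * n + p * (al + 1).

Definition row_u1 al p n : R := 2 * p * (al + 1) / row_den al p n.
Definition row_v1 al be p n : R := - (2 * n * (n + al + 1) *
  ((1 + p) * n + (p * (be + 1) + al + be + 2)) / (row_N al be n * (row_N al be n + 1) *
      row_den al p n)).
Definition row_u2 al be p n : R := (2 * p * (n + al + 1) * (n + al + 2) * (n + al + be + 2)
  + 2 * n * (n + 1) * (n + be + 1)) / ((row_N al be n + 1) * (row_N al be n + 2) * row_den
      al p n).
Definition row_v2 al be p n : R := - (2 * (al + 1) * n * (n + al + 1) / (row_N al be n *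
    (row_N al be n + 1) * row_den al p n)).

Definition tau1 al be n : R := - (2 * n * (n + be + 1) / (row_N al be n + 1)).
Definition tau2 al be n : R := 2 * n * (n + be + 1) / (row_N al be n + 1) * ((n - 1) * (n +
    be) / row_N al be n).
Definition tau1_pred al be n : R := - (2 * (n - 1) * (n + be) / (row_N al be n - 1)).
Definition sigma1 al be n : R := - (2 * n * (n + be) / row_N al be n).
Definition sigma1_succ al be n : R := - (2 * (n + 1) * (n + be + 1) / (row_N al be n + 2)).
Definition sigma2_succ al be n : R := 2 * (n + 1) * (n + be + 1) / (row_N al be n + 2) * (n
    * (n + be) / (row_N al be n + 1)).

(* The coefficients of z^(n-1) and z^(n-2) in the (i, j) entry of P_n, expanded in z. *)
Definition subleading al be p (i j : 'I_2) n : R :=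
  if i == 0 then (if j == 0 then tau1 al be n + row_v1 al be p n else 2 - row_u1 al p n)
  else (if j == 0 then row_v2 al be p n else 2 + sigma1_succ al be n - row_u2 al be p n).

Definition subsubleading al be p (i j : 'I_2) n : R :=
  if i == 0 then
    (if j == 0 then tau2 al be n + row_v1 al be p n * tau1_pred al be n
     else 2 * (tau1 al be n + row_v1 al be p n) + 2 * (2 - row_u1 al p n) - row_u1 al p n *
         sigma1 al be n)
  else
    (if j == 0 then row_v2 al be p n * tau1_pred al be n
     else 2 * row_v2 al be p n + 2 * (2 + sigma1_succ al be n - row_u2 al be p n) +
         sigma2_succ al be n - row_u2 al be p n * sigma1 al be n).

(** The n^0 coefficient of [subleading], whose term of order n is -n on the diagonal. *)
Definition subleading1 al be (i j : 'I_2) : R :=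
  if i == 0 then (if j == 0 then (al - be - 1) / 2 else 2)
  else (if j == 0 then 0 else (al - be + 2) / 2).

(** The 1 / n coefficient of [subleading]; entrywise it is the matrix [B2], since differencing moves
    it to 1 / n^2. *)
Definition subleading2 al be p (i j : 'I_2) : R :=
  if i == 0 then
    (if j == 0 then ((be + 1) ^+ 2 - al ^+ 2) / 4 - (al + 1) / (1 + p)
     else - (2 * p * (al + 1) / (1 + p)))
  else
    (if j == 0 then - ((al + 1) / (1 + p) / 2)
     else (be ^+ 2 - (al + 2) ^+ 2) / 4 + (al + 1) / (1 + p)).

End Coefficients.

Section CoefficientExpansions.
Context {R : realType}.
Implicit Types (al be p : R).

(** The bound is 1 rather than 0 because [tau1_pred] has the denominator [row_N - 1]. *)
Lemma row_N_gt1 al be (m : nat) : -1 < al -> -1 < be -> (0 < m)%N -> 1 < row_N al be m%:R.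
Proof.
move=> hal hbe m0; have : 1 <= m%:R :> R by rewrite ler1n.
by rewrite /row_N; move: m%:R => x ?; lra.
Qed.

Lemma row_den_gt0 al p (m : nat) : -1 < al -> 0 < p -> (0 < m)%N -> 0 < row_den al p m%:R.
Proof.
rewrite -(ltr0n R) => hal hp m0; rewrite /row_den.
have a1 : 0 < al + 1 by lra.
have p1 : 0 < 1 + p by lra.
by rewrite addr_gt0 // mulr_gt0.
Qed.

Ltac row_eq_tac hal hbe hp :=
  exists 1%N => ? ?;
  rewrite /tau1 /tau2 /tau1_pred /sigma1 /sigma1_succ /sigma2_succ /row_u1 /row_u2 /row_v1
      /row_v2 /row_N /row_den /invn; field;
  match goal with H : is_true (0 < _)%N |- _ =>
    have := row_N_gt1 _ _ _ hal hbe H; have := row_den_gt0 _ _ _ hal hp H; move: H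
  end;
  rewrite /row_N /row_den -(ltr0n R); move: (_%:R) => ? ? ? ?;
  repeat (apply/andP; split); rewrite gt_eqF //; lra.

Ltac expansion_tac := repeat first
  [ apply: expansion_inv_lin | apply: expansion_lin | apply: expansion_invn
  | eapply expansionM | eapply expansionD | apply: expansion_cst ].

(* The expansions are read off after rewriting each coefficient as a polynomial in 1 / m,
   (k m + d) / m and m / (k m + d). *)
Notation inv k d := (fun m : nat => m%:R / (k * m%:R + d)).
Notation lin k d := (fun m : nat => (k * m%:R + d) * invn m).

Lemma expansion_subleading al be p i j : -1 < al -> -1 < be -> 0 < p -> exists c3 : R,
  expansion (fun m : nat => subleading al be p i j m%:R * invn m)
    (- (i == j)%:R) (subleading1 al be i j) (subleading2 al be p i j) c3.
Proof.
move=> hal hbe hp.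
have k1 : 0 < 1 + p by lra.
have k2 : 0 < 2 :> R by lra.
have kn : 1 + p != 0 by rewrite gt_eqF.
rewrite /subleading /subleading1 /subleading2.
case: i => [[|[|//]] hi]; case: j => [[|[|//]] hj] /=; eexists.
(* In the sum of [tau1] and [row_v1] the factor [row_N + 1] cancels; the first fraction then carries
   the leading term -1 and the second is O(1 / n^2). *)
- eapply (expansion_eq (fun m => (-2) * (lin 1 (be + 1) m * inv 2 (al + be + 1) m) + (-2) *
    (al + 1) * (invn m * invn m * (inv 2 (al + be + 1) m * inv (1 + p) (p * (al + 1)) m)))).
  + by expansion_tac.
  + by row_eq_tac hal hbe hp.
  + by field; rewrite ?kn.
  + by field; rewrite ?kn.
  + by field; rewrite ?kn.
  + reflexivity.
- eapply (expansion_eq (fun m => 2 * invn m + (-2) * p * (al + 1) * (invn m * invn m * inv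
    (1 + p) (p * (al + 1)) m))).
  + by expansion_tac.
  + by row_eq_tac hal hbe hp.
  + by field; rewrite ?kn.
  + by field; rewrite ?kn.
  + by field; rewrite ?kn.
  + reflexivity.
- eapply (expansion_eq (fun m => (-2) * (al + 1) * (invn m * invn m * (lin 1 (al + 1) m *
    (inv 2 (al + be + 1) m * (inv 2 (al + be + 2) m * inv (1 + p) (p * (al + 1)) m)))))).
  + by expansion_tac.
  + by row_eq_tac hal hbe hp.
  + by field; rewrite ?kn.
  + by field; rewrite ?kn.
  + by field; rewrite ?kn.
  + reflexivity.
(* Likewise [row_N + 2] cancels between [sigma1_succ] and [row_u2]. *)
- eapply (expansion_eq (fun m => 2 * invn m + ((-2) * (lin 1 1 m * (lin 1 (be + 1) m * inv
    2 (al + be + 2) m)) + (-2) * p * (al + 1) * (invn m * invn m * (lin 1 (al + 1) m * (inv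
    2 (al + be + 2) m * inv (1 + p) (p * (al + 1)) m)))))).
  + by expansion_tac.
  + by row_eq_tac hal hbe hp.
  + by field; rewrite ?kn.
  + by field; rewrite ?kn.
  + by field; rewrite ?kn.
  + reflexivity.
Qed.

(** The second coefficient produces the limit of C_n: on the diagonal, -(2 n + 1) / 2 + 3 / 4 +
    [subleading1] minus (-n + [subleading1]) equals 1 / 4, and off the diagonal the [subleading1]
    terms cancel. The values of c2 and c3 enter only the error term. *)
Lemma expansion_subsubleading al be p i j : -1 < al -> -1 < be -> 0 < p -> exists c2 : R,
    exists c3 : R,
  expansion (fun m : nat => subsubleading al be p i j m%:R * invn m ^+ 2)
    ((i == j)%:R / 2) (- (3 / 4) * (i == j)%:R - subleading1 al be i j) c2 c3.
Proof.
move=> hal hbe hp.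
have k1 : 0 < 1 + p by lra.
have k2 : 0 < 2 :> R by lra.
have kn : 1 + p != 0 by rewrite gt_eqF.
rewrite /subsubleading /subleading1.
case: i => [[|[|//]] hi]; case: j => [[|[|//]] hj] /=; do 2 eexists.
- eapply (expansion_eq (fun m => 2 * (lin 1 (be + 1) m * (lin 1 (-1) m * (lin 1 be m *
    (inv 2 (al + be + 1) m * inv 2 (al + be + 2) m)))) + (-2) * (invn m * (lin 1 (al + 1) m
    * (lin (1 + p) (p * (be + 1) + al + be + 2) m * (inv 2 (al + be + 1) m * (inv 2 (al + be
    + 2) m * inv (1 + p) (p * (al + 1)) m))))) * ((-2) * (lin 1 (-1) m * (lin 1 be m * inv
    2 (al + be) m))))).
  + by expansion_tac.
  + by row_eq_tac hal hbe hp.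
  + by field; rewrite ?kn.
  + by field; rewrite ?kn.
  + reflexivity.
  + reflexivity.
- eapply (expansion_eq (fun m => (2 * invn m * ((-2) * (lin 1 (be + 1) m * inv 2 (al + be +
    1) m) + (-2) * (al + 1) * (invn m * invn m * (inv 2 (al + be + 1) m * inv (1 + p) (p *
    (al + 1)) m))) + 2 * invn m * (2 * invn m + (-2) * p * (al + 1) * (invn m * invn m * inv
    (1 + p) (p * (al + 1)) m))) + (-1) * ((2 * p * (al + 1) * (invn m * invn m * inv (1 + p)
    (p * (al + 1)) m)) * ((-2) * (lin 1 be m * inv 2 (al + be + 1) m))))).
  + by expansion_tac.
  + by row_eq_tac hal hbe hp.
  + by field; rewrite ?kn.
  + by field; rewrite ?kn.
  + reflexivity.
  + reflexivity.
- eapply (expansion_eq (fun m => ((-2) * (al + 1) * (invn m * invn m * (lin 1 (al + 1) m *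
    (inv 2 (al + be + 1) m * (inv 2 (al + be + 2) m * inv (1 + p) (p * (al + 1)) m))))) *
    ((-2) * (lin 1 (-1) m * (lin 1 be m * inv 2 (al + be) m))))).
  + by expansion_tac.
  + by row_eq_tac hal hbe hp.
  + by field; rewrite ?kn.
  + by field; rewrite ?kn.
  + reflexivity.
  + reflexivity.
- eapply (expansion_eq (fun m => (2 * invn m * ((-2) * (al + 1) * (invn m * invn m * (lin 1
    (al + 1) m * (inv 2 (al + be + 1) m * (inv 2 (al + be + 2) m * inv (1 + p) (p * (al +
    1)) m))))) + 2 * invn m * (2 * invn m + ((-2) * (lin 1 1 m * (lin 1 (be + 1) m * inv 2
    (al + be + 2) m)) + (-2) * p * (al + 1) * (invn m * invn m * (lin 1 (al + 1) m * (inv 2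
    (al + be + 2) m * inv (1 + p) (p * (al + 1)) m)))))) + (2 * (lin 1 1 m * (lin 1 (be +
    1) m * (lin 1 be m * (inv 2 (al + be + 2) m * inv 2 (al + be + 3) m)))) + (-1) *
    ((invn m * ((2 * p * (lin 1 (al + 1) m * (lin 1 (al + 2) m * lin 1 (al + be + 2) m)) + 2
    * (lin 1 1 m * lin 1 (be + 1) m)) * (inv 2 (al + be + 2) m * (inv 2 (al + be + 3) m *
    inv (1 + p) (p * (al + 1)) m)))) * ((-2) * (lin 1 be m * inv 2 (al + be + 1) m)))))).
  + by expansion_tac.
  + by row_eq_tac hal hbe hp.
  + by field; rewrite ?kn.
  + by field; rewrite ?kn.
  + reflexivity.
  + reflexivity.
Qed.

End CoefficientExpansions.

(** * Solving for a row of P_n *)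

Section Rows.
Context {R : realType}.
Implicit Types (al be p : R) (a b c d r : {poly R}).

(** Cramer's rule; the determinant of the system is [row_den] / N. Here s is the top coefficient of
    [f], the negative of that of [b], hence its minus sign in the solution. *)
Lemma row_solution al be p (n t s u v : R) : -1 < al -> -1 < be -> 0 < p -> 1 <= n ->
  let N := row_N al be n in
  u * (n + al + 1) / N - v =
    2 * t * (n + al + 1) * (n + al + be + 2) / (N * (N + 1))
    - 2 * s * (n + al + 1) * (n + al + 2) * (n + al + be + 2) / (N * (N + 1) * (N + 2)) ->
  u * n / N + p * v =
    - (2 * s * n * (n + 1) * (n + be + 1) / (N * (N + 1) * (N + 2)))
    - 2 * p * t * n * (n + be + 1) / (N * (N + 1)) ->
  u = t * row_u1 al p n - s * row_u2 al be p n /\ v = t * row_v1 al be p n - s * row_v2 al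
      be p n.
Proof.
move=> hal hbe hp n1 N e1 e2.
have N0 : 0 < N by rewrite /N /row_N; lra.
have D0 : row_den al p n != 0.
  have a1 : 0 < al + 1 by lra.
  have p1 : 0 < 1 + p by lra.
  by rewrite gt_eqF // /row_den addr_gt0 // mulr_gt0 //; lra.
have nz : [/\ N != 0, N + 1 != 0 & N + 2 != 0] by split; rewrite gt_eqF //; lra.
have [n0 n1' n2] := nz.
have DE : row_den al p n / N = p * ((n + al + 1) / N) + n / N by rewrite /row_den; field.
have uE : u * (row_den al p n / N) = p * (u * (n + al + 1) / N - v) + (u * n / N + p * v).
  by rewrite DE; ring.
have vE : v * (row_den al p n / N) = (n + al + 1) / N * (u * n / N + p * v)
    - n / N * (u * (n + al + 1) / N - v).
  by rewrite DE; ring.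
have DN0 : row_den al p n / N != 0 by rewrite mulf_neq0 // invr_eq0.
rewrite e1 e2 in uE vE.
split.
  apply: (mulIf DN0); rewrite uE /row_u1 /row_u2 -/N; move: D0 n0 n1' n2.
  by rewrite /N /row_N /row_den => D0 n0 n1' n2; field; rewrite D0 n0 n1' n2.
apply: (mulIf DN0); rewrite vE /row_v1 /row_v2 -/N; move: D0 n0 n1' n2.
by rewrite /N /row_N /row_den => D0 n0 n1' n2; field; rewrite D0 n0 n1' n2.
Qed.

(** The Jacobi expansions determine [a] and [f]; then [b] is read off from the top by b_j = 2
    a_(j+1) + 2 b_(j+1) - f_(j+1), with no division by 2 - z. *)
Lemma row_coefficients al be p m (s t : R) a b :
  -1 < al -> -1 < be -> 0 < p ->
  (size (a - t *: 'X^(m.+2))%R <= m.+2)%N -> (size (b - s *: 'X^(m.+2))%R <= m.+2)%N ->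
  let f := 2 *: a + (2%:P - 'X) * b in
  (forall r, (size r <= m.+1)%N -> jacobi_fun (al + 1) (be + 1) (a * r) = 0) ->
  (forall r, (size r <= m.+2)%N -> jacobi_fun (al + 1) be (f * r) = 0) ->
  jacobi_fun al be f + p * jacobi_fun al (be + 1) a = 0 ->
  let n := m.+2%:R in
  let u := t * row_u1 al p n + s * row_u2 al be p n in
  let v := t * row_v1 al be p n + s * row_v2 al be p n in
  [/\ a`_m.+1 = t * tau1 al be n + v,
      a`_m = t * tau2 al be n + v * tau1_pred al be n,
      b`_m.+1 = 2 * t + 2 * s + s * sigma1_succ al be n - u &
      b`_m = 2 * (a`_m.+1 + b`_m.+1) + s * sigma2_succ al be n - u * sigma1 al be n].
Proof.
move=> hal hbe hp sa sb f h1 h2 h3 n u v.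
have a0 : 0 < al + 1 by lra.
have b1 : -1 < be + 1 by lra.
have am : a`_m.+2 = t.
  have /leq_sizeP/(_ m.+2 (leqnn _)) := sa.
  by rewrite coefB coefZ coefXn eqxx mulr1 => /subr0_eq.
have bm : b`_m.+2 = s.
  have /leq_sizeP/(_ m.+2 (leqnn _)) := sb.
  by rewrite coefB coefZ coefXn eqxx mulr1 => /subr0_eq.
have highcoef (q : {poly R}) (k : R) j : (size (q - k *: 'X^(m.+2))%R <= m.+2)%N ->
    (m.+2 < j)%N -> q`_j = 0.
  move=> hq hj; have /leq_sizeP/(_ j (ltnW hj)) := hq.
  by rewrite coefB coefZ coefXn gtn_eqF // mulr0 subr0.
have fcoef j : f`_j.+1 = 2 * a`_j.+1 + (2 * b`_j.+1 - b`_j).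
  by rewrite coefD coefZ mulrBl coefB coefCM coefXM.
have sa' : (size a <= m.+3)%N by apply/leq_sizeP => j hj; exact: (highcoef _ _ _ sa hj).
have sf : (size f <= m.+4)%N.
  apply/leq_sizeP => -[//|j] hj; rewrite fcoef.
  rewrite (highcoef a t j.+1 sa (ltnW hj)) (highcoef b s j.+1 sb (ltnW hj)).
  by rewrite (highcoef b s j sb hj) !mulr0 subrr addr0.
have [v' aE] := jacobi_two_terms m.+1 _ _ a a0 b1 sa' h1.
have [u' fE] := jacobi_two_terms m.+2 _ _ f a0 hbe sf h2.
have fm : f`_m.+3 = - s.
  by rewrite fcoef bm (highcoef a t _ sa) // (highcoef b s m.+3 sb) // !mulr0 !add0r.
rewrite am in aE; rewrite fm in fE.
have f2 : f.[2] = 2 * a.[2].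
  by rewrite /f hornerD hornerZ hornerM hornerD hornerN hornerC hornerX subrr mul0r addr0.
have [e1 e2] := row_system _ _ _ _ _ _ _ _ _ _ hal hbe aE fE f2 h3.
have nE : m.+1%:R + 1 = n by rewrite natr1.
rewrite nE in e1 e2.
have n1 : 1 <= n by rewrite ler1n.
have [uE vE] := row_solution al be p n t (- s) u' v' hal hbe hp n1 e1 e2.
rewrite !mulNr !opprK -/u -/v in uE vE; rewrite {}uE in fE; rewrite {}vE in aE.
have n2 : 2 <= n by rewrite ler_nat.
have E1 : m.+1%:R = n - 1 by rewrite -nE addrK.
have E0 : m%:R = n - 2 by rewrite -[m%:R](addrK 1) natr1 E1; ring.
have E3 : m.+3%:R = n + 1 by rewrite -natr1.
have N0 : 1 < row_N al be n by rewrite /row_N; lra.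
have t1 : (jacobi_poly m.+2 (al + 1) (be + 1))`_m.+1 = tau1 al be n.
  rewrite coef_jacobi_poly1 // /tau1 /row_N -/n; congr (- (_ / _)); ring.
have t2 : (jacobi_poly m.+2 (al + 1) (be + 1))`_m = tau2 al be n.
  rewrite coef_jacobi_poly2 // /tau2 /row_N -/n E1.
  by congr (_ / _ * (_ / _)); ring.
have t1p : (jacobi_poly m.+1 (al + 1) (be + 1))`_m = tau1_pred al be n.
  rewrite coef_jacobi_poly1 // /tau1_pred /row_N E1; congr (- (_ / _)); ring.
have s1 : (jacobi_poly m.+2 (al + 1) be)`_m.+1 = sigma1 al be n.
  rewrite coef_jacobi_poly1 // /sigma1 /row_N -/n; congr (- (_ / _)); ring.
have s1s : (jacobi_poly m.+3 (al + 1) be)`_m.+2 = sigma1_succ al be n.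
  rewrite coef_jacobi_poly1 // /sigma1_succ /row_N E3; congr (- (_ / _)); ring.
have s2s : (jacobi_poly m.+3 (al + 1) be)`_m.+1 = sigma2_succ al be n.
  rewrite coef_jacobi_poly2 // /sigma2_succ /row_N E3 -/n.
  by congr (_ / _ * (_ / _)); ring.
have aE1 : a`_m.+1 = t * tau1 al be n + v.
  by rewrite aE coefD !coefZ t1 coef_jacobi_poly_lead // mulr1.
have aE0 : a`_m = t * tau2 al be n + v * tau1_pred al be n.
  by rewrite aE coefD !coefZ t2 t1p.
have fE2 : f`_m.+2 = - s * sigma1_succ al be n + u.
  by rewrite fE coefD !coefZ s1s coef_jacobi_poly_lead // mulr1.
have fE1 : f`_m.+1 = - s * sigma2_succ al be n + u * sigma1 al be n.
  by rewrite fE coefD !coefZ s2s s1.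
have bE1 : b`_m.+1 = 2 * a`_m.+2 + 2 * b`_m.+2 - f`_m.+2 by rewrite fcoef; ring.
have bE0 : b`_m = 2 * a`_m.+1 + 2 * b`_m.+1 - f`_m.+1 by rewrite fcoef; ring.
split => //.
  by rewrite bE1 am bm fE2; ring.
by rewrite bE0 fE1; ring.
Qed.

End Rows.

(** * From matrix orthogonality to the scalar conditions *)

Section MatrixOrthogonality.
Context {R : realType}.
Implicit Types (al be p : R) (a b c d r : {poly R}).

(* Four times the pairing of the rows (a, b) and (c, d) under the matrix weight, because
   4 W = w (v v^T + 2 p z e1 e1^T) with v = (2, 2 - z) and z = 1 + x. *)
Definition row_form al be p a b c d : R :=
  jacobi_fun al be ((2 *: a + (2%:P - 'X) * b) * (2 *: c + (2%:P - 'X) * d)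
    + (2 * p) *: ('X * (a * c))).

Lemma row_formD al be p a b c d c' d' : -1 < al -> -1 < be ->
  row_form al be p a b (c + c') (d + d') =
  row_form al be p a b c d + row_form al be p a b c' d'.
Proof.
move=> hal hbe; rewrite /row_form -jacobi_funD //; congr (jacobi_fun _ _ _).
by rewrite -!mul_polyC; ring.
Qed.

Lemma row_formZ al be p a b k c d : -1 < al -> -1 < be ->
  row_form al be p a b (k *: c) (k *: d) = k * row_form al be p a b c d.
Proof.
move=> hal hbe; rewrite /row_form -jacobi_funZ //; congr (jacobi_fun _ _ _).
by rewrite -!mul_polyC; ring.
Qed.

Definition shiftp (q : {poly R}) : {poly R} := q \Po ('X - 1%:P).

Lemma horner_shiftp q x : (shiftp q).[1 + x] = q.[x].
Proof. by rewrite horner_comp hornerD hornerN hornerX hornerC addrAC subrr add0r. Qed.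

Lemma mx_int_row_form al be p (P Q : 'M[{poly R}]_2) i j : -1 < al -> -1 < be ->
  mx_int (fun x => mxpeval P x *m Wt al be p x *m (mxpeval Q x)^T) i j =
  4^-1 * row_form al be p (shiftp (P i 0)) (shiftp (P i 1)) (shiftp (Q j 0)) (shiftp (Q j
      1)).
Proof.
move=> hal hbe; rewrite /row_form -jacobi_funZ // mxE.
apply: eq_Rintegral => x _.
rewrite !hornerE !horner_shiftp.
rewrite mxE !big_ord_recl big_ord0 !mxE !big_ord_recl !big_ord0 !mxE /=.
have -> : lift ord0 ord0 = 1 :> 'I_2 by apply/val_inj.
rewrite /jacobi_weight.
have -> : ord0 = 0 :> 'I_2 by [].
move: (P i 0).[x] (P i 1).[x] (Q j 0).[x] (Q j 1).[x] => a b c d.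
by field.
Qed.

(** Passing from x to z = 1 + x keeps monicity, since (z - 1)^n - z^n has degree below n. *)
Lemma monic_shiftp n (P : 'M[{poly R}]_2) i j : monic_mxpoly_deg n P ->
  (size (shiftp (P i j) - ((i == j)%:R : R) *: 'X^n)%R <= n)%N.
Proof.
move=> /(_ i j) hP.
have -> : shiftp (P i j) - ((i == j)%:R : R) *: 'X^n =
  shiftp (P i j - (i == j)%:R * 'X^n) +
  ((i == j)%:R : R) *: (('X - 1%:P) ^+ n - 1 *: 'X^n).
  rewrite /shiftp comp_polyB comp_polyM comp_Xn_poly scale1r scalerBr.
  case: (i == j); last by rewrite !scale0r comp_polyC !mul0r; ring.
  by rewrite !scale1r comp_polyC !mul1r; ring.
apply: (leq_trans (size_polyD _ _)); rewrite geq_max; apply/andP; split.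
  by rewrite size_comp_poly2 ?size_XsubC.
apply: (leq_trans (size_scale_leq _ _)).
have e : (('X - 1%:P) ^+ n : {poly R})`_n = 1.
  have := monic_exp n (monicXsubC (1 : R)) => /monicP.
  by rewrite /lead_coef size_exp_XsubC.
rewrite -{2}e; apply: size_sub_lead; rewrite ?size_exp_XsubC ?size_polyXn //.
by rewrite coefXn eqxx.
Qed.

(** Induction on a degree bound: multiples of the two rows of the monic P_k remove the top
    coefficients of (c, d), and these rows are orthogonal to P_n for k < n. *)
Lemma MOPS_orthogonal al be p (P : nat -> 'M[{poly R}]_2) n i c d :
  -1 < al -> -1 < be -> monic_MOPS (Wt al be p) P ->
  (size c <= n)%N -> (size d <= n)%N ->
  row_form al be p (shiftp (P n i 0)) (shiftp (P n i 1)) c d = 0.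
Proof.
move=> hal hbe [mon orth].
suff H k : (k <= n)%N -> forall c d, (size c <= k)%N -> (size d <= k)%N ->
    row_form al be p (shiftp (P n i 0)) (shiftp (P n i 1)) c d = 0 by exact: H.
elim: k => [|k IHk] kn {}c {}d.
  rewrite !leqn0 !size_poly_eq0 => /eqP -> /eqP ->.
  by rewrite -(scale0r 0) row_formZ // mul0r.
move=> sc sd.
pose Q i j := shiftp (P k i j).
have orthk j : row_form al be p (shiftp (P n i 0)) (shiftp (P n i 1)) (Q j 0) (Q j 1) = 0.
  have nk : n <> k by move=> e; rewrite e ltnn in kn.
  have := orth n k nk => /matrixP/(_ i j).
  rewrite mx_int_row_form // [RHS]mxE => /eqP; rewrite mulf_eq0 invr_eq0 pnatr_eq0 /=.
  by move/eqP.
have Qlow i' j' l : (k <= l)%N -> (Q i' j')`_l = ((i' == j')%:R * (l == k)%:R).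
  move=> kl; have := monic_shiftp k (P k) i' j' (mon k) => /leq_sizeP/(_ l kl).
  by rewrite coefB coefZ coefXn => /subr0_eq.
pose ck := c`_k; pose dk := d`_k.
have -> : c = (c - (ck *: Q 0 0 + dk *: Q 1 0)) + (ck *: Q 0 0 + dk *: Q 1 0).
  by rewrite subrK.
have -> : d = (d - (ck *: Q 0 1 + dk *: Q 1 1)) + (ck *: Q 0 1 + dk *: Q 1 1).
  by rewrite subrK.
rewrite row_formD // [X in _ + X]row_formD // !row_formZ // !orthk !mulr0 !addr0.
apply: IHk; first exact: ltnW.
  apply/leq_sizeP => l; rewrite leq_eqVlt => /orP[/eqP <-|kl].
    by rewrite coefB coefD !coefZ !Qlow // !eqxx /= !(mulr1, mulr0, mul0r) addr0 /ck subrr.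
  rewrite coefB coefD !coefZ !Qlow ?(ltnW kl) // gtn_eqF // !mulr0 addr0 subr0.
  by rewrite nth_default // (leq_trans sc).
apply/leq_sizeP => l; rewrite leq_eqVlt => /orP[/eqP <-|kl].
  by rewrite coefB coefD !coefZ !Qlow // !eqxx /= !(mulr1, mulr0, mul0r) add0r /dk subrr.
rewrite coefB coefD !coefZ !Qlow ?(ltnW kl) // gtn_eqF // !mulr0 addr0 subr0.
by rewrite nth_default // (leq_trans sd).
Qed.

Lemma ord2P (i : 'I_2) : i = 0 \/ i = 1.
Proof. by case: i => [[|[|//]] hi]; [left|right]; apply: val_inj. Qed.

Lemma MOPS_coefficients al be p (P : nat -> 'M[{poly R}]_2) m i j :
  -1 < al -> -1 < be -> 0 < p -> monic_MOPS (Wt al be p) P ->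
  (shiftp (P m.+2 i j))`_m.+1 = subleading al be p i j m.+2%:R /\
  (shiftp (P m.+2 i j))`_m = subsubleading al be p i j m.+2%:R.
Proof.
move=> hal hbe hp mops.
pose a := shiftp (P m.+2 i 0); pose b := shiftp (P m.+2 i 1).
have orth c d sc sd := MOPS_orthogonal al be p P m.+2 i c d hal hbe mops sc sd.
rewrite -/a -/b in orth.
have [mon _] := mops.
have sa := monic_shiftp m.+2 (P m.+2) i 0 (mon _).
have sb := monic_shiftp m.+2 (P m.+2) i 1 (mon _).
have h1 r : (size r <= m.+1)%N -> jacobi_fun (al + 1) (be + 1) (a * r) = 0.
  move=> sr.
  have s1 : (size ((2%:P - 'X) * r)%R <= m.+2)%N.
    by apply: (leq_trans (size_polyMleq _ _)); rewrite size_flip addSn add1n /= ltnS.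
  have s2 : (size ((-2) *: r)%R <= m.+2)%N.
    by rewrite (leq_trans (size_scale_leq _ _)) // (leq_trans sr).
  have := orth _ _ s1 s2.
  (* This row has g = 0, so only the coupling term 2 p z a c remains; its factor z (2 - z) raises
     both exponents. *)
  have -> : row_form al be p a b ((2%:P - 'X) * r) ((-2) *: r) =
      2 * p * jacobi_fun (al + 1) (be + 1) (a * r).
    rewrite -jacobi_funMl -jacobi_funMr -jacobi_funZ //.
    by congr (jacobi_fun _ _ _); rewrite -!mul_polyC; ring.
  by move/eqP; rewrite !mulf_eq0 pnatr_eq0 (gt_eqF hp) /= => /eqP.
have h2 r : (size r <= m.+2)%N ->
    jacobi_fun (al + 1) be ((2 *: a + (2%:P - 'X) * b) * r) = 0.
  (* With first component 0 the coupling term disappears and g = (2 - z) r. *)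
  move=> sr; have := orth 0 r; rewrite size_poly0 => /(_ isT sr) <-.
  rewrite -jacobi_funMl; congr (jacobi_fun _ _ _); rewrite -!mul_polyC; ring.
have h3 : jacobi_fun al be (2 *: a + (2%:P - 'X) * b) + p * jacobi_fun al (be + 1) a = 0.
  (* The row (1, 0) has g = 2, which gives twice the claimed relation. *)
  have := orth 1 0; rewrite size_poly0 size_poly1 => /(_ isT isT) e.
  have k2 : (2 : R) != 0 by rewrite pnatr_eq0.
  apply: (mulfI k2); rewrite mulr0 -[RHS]e -jacobi_funMr -!jacobi_funZ // -jacobi_funD //.
  rewrite -jacobi_funZ //; congr (jacobi_fun _ _ _); rewrite -!mul_polyC; ring.
have [e1 e2 e3 e4] := row_coefficients al be p m _ _ a b hal hbe hp sa sb h1 h2 h3.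
case: (ord2P j) => ->; rewrite -/a -/b ?e4 ?e3 ?e2 ?e1 /subleading /subsubleading.
  by case: (ord2P i) => -> /=; split; ring.
by case: (ord2P i) => -> /=; split; ring.
Qed.

End MatrixOrthogonality.

(** * Recurrence coefficients from subleading coefficients *)

Section Recurrence.
Context {R : realType}.

Lemma sum_ord2 (F : 'I_2 -> R) : \sum_i F i = F 0 + F 1.
Proof. by rewrite !big_ord_recl big_ord0 addr0; congr (F _ + F _); apply: val_inj. Qed.

Lemma three_term_shiftp (P : nat -> 'M[{poly R}]_2) (B C : nat -> 'M[R]_2) m i j :
  three_term P B C ->
  'X * shiftp (P m.+1 i j) = shiftp (P m.+2 i j) + shiftp (P m.+1 i j)
    + (B m.+1 i 0 *: shiftp (P m.+1 0 j) + B m.+1 i 1 *: shiftp (P m.+1 1 j))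
    + (C m.+1 i 0 *: shiftp (P m 0 j) + C m.+1 i 1 *: shiftp (P m 1 j)).
Proof.
move=> [_ /(_ m.+1 isT) /matrixP/(_ i j)].
rewrite mul_scalar_mx !mxE !big_ord_recl !big_ord0 !mxE !addr0 /=.
have -> : lift ord0 ord0 = 1 :> 'I_2 by apply/val_inj.
have -> : ord0 = 0 :> 'I_2 by [].
move/(congr1 shiftp).
rewrite /shiftp !(comp_polyD, comp_polyM, comp_polyC, comp_polyX) !mul_polyC mulrBl mul1r.
by move/eqP; rewrite subr_eq => /eqP ->; ring.
Qed.

(** Compares the coefficients of z^(m+2) and z^(m+1). The identity accompanying B comes from x = z -
    1; C enters only the second comparison, where it meets the monic top of P_(m+1). *)
Lemma recurrence_coefficients (P : nat -> 'M[{poly R}]_2) (B C : nat -> 'M[R]_2) m i j :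
  (forall n, monic_mxpoly_deg n (P n)) -> three_term P B C ->
  let Q n i j := shiftp (P n i j) in
  B m.+2 i j = (Q m.+2 i j)`_m.+1 - (Q m.+3 i j)`_m.+2 - (i == j)%:R /\
  C m.+2 i j = (Q m.+2 i j)`_m - (Q m.+3 i j)`_m.+1 -
    \sum_k (B m.+2 i k + (i == k)%:R) * (Q m.+2 k j)`_m.+1.
Proof.
move=> mon tt Q; rewrite {}/Q.
have Qlow n l i' j' : (n <= l)%N -> (shiftp (P n i' j'))`_l = ((i' == j')%:R * (l == n)%:R).
  move=> nl; have := monic_shiftp n (P n) i' j' (mon n) => /leq_sizeP/(_ l nl).
  by rewrite coefB coefZ coefXn => /subr0_eq.
have top n i' j' : (shiftp (P n i' j'))`_n = (i' == j')%:R.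
  by rewrite Qlow // eqxx mulr1.
have above i' j' : (shiftp (P m.+1 i' j'))`_m.+2 = 0.
  by rewrite Qlow // gtn_eqF // mulr0.
have E := three_term_shiftp P B C m.+1 i j tt.
have := congr1 (fun q : {poly R} => q`_m.+2) E.
rewrite coefXM /= !coefD !coefZ !top !above !mulr0 !addr0 => e1.
have := congr1 (fun q : {poly R} => q`_m.+1) E.
rewrite coefXM /= !coefD !coefZ !top => e2.
rewrite e1 e2 sum_ord2 {e1 e2 E}.
by case: (ord2P i) => ->; case: (ord2P j) => -> /=; split; ring.
Qed.

Lemma uniform_bound2 (F : 'I_2 -> nat -> R) (e : nat -> R) :
  (forall n, 0 <= e n) ->
  (forall i, exists K, exists N0, forall n, (N0 <= n)%N -> F i n <= K * e n) ->
  exists K, exists N0, forall n, (N0 <= n)%N -> forall i, F i n <= K * e n.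
Proof.
move=> e0 H; have [K [N0 HK]] := H 0; have [L [N1 HL]] := H 1.
exists (Num.max K L), (maxn N0 N1) => n; rewrite geq_max => /andP[h0 h1] i.
case: (ord2P i) => ->.
  by apply: (le_trans (HK n h0)); rewrite ler_wpM2r // le_max lexx.
by apply: (le_trans (HL n h1)); rewrite ler_wpM2r // le_max lexx orbT.
Qed.

Lemma uniform_bound22 (F : 'I_2 -> 'I_2 -> nat -> R) (e : nat -> R) :
  (forall n, 0 <= e n) ->
  (forall i j, exists K, exists N0, forall n, (N0 <= n)%N -> F i j n <= K * e n) ->
  exists K, exists N0, forall n, (N0 <= n)%N -> forall i j, F i j n <= K * e n.
Proof.
move=> e0 H.
have H1 i : exists K, exists N0, forall n, (N0 <= n)%N ->
    Num.max (F i 0 n) (F i 1 n) <= K * e n.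
  have [K [N0 HK]] := uniform_bound2 (F i) e e0 (H i).
  by exists K, N0 => n hn; rewrite ge_max !HK.
have [K [N0 HK]] := uniform_bound2 _ e e0 H1.
exists K, N0 => n hn i j; have := HK n hn i; rewrite ge_max => /andP[g0 g1].
by case: (ord2P j) => ->.
Qed.

End Recurrence.

Theorem corollary2p4 (R : realType) (al be p : R)
    (hal : -1 < al) (hbe : -1 < be) (hp : 0 < p)
    (P : nat -> 'M[{poly R}]_2) (B C : nat -> 'M[R]_2) :
  monic_MOPS (Wt al be p) P ->
  three_term P B C ->
  let B2 : 'M[R]_2 :=
    (1 / 4) *: mx22 ((be + 1) ^+ 2 - al ^+ 2) 0 0 (be ^+ 2 - (al + 2) ^+ 2)
    - ((al + 1) / (1 + p)) *: mx22 1 (2 * p) (1 / 2) (-1) in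
  (exists K : R, exists N : nat, forall n : nat, (N <= n)%N ->
     forall i j : 'I_2,
       `| B n i j - B2 i j / (n%:R ^+ 2) | <= K / (n%:R ^+ 3)) /\
  (exists K : R, exists N : nat, forall n : nat, (N <= n)%N ->
     forall i j : 'I_2,
       `| C n i j - ((1 / 4) *: (1%:M : 'M[R]_2)) i j | <= K / (n%:R ^+ 2)).
Proof.
move=> mops tt B2.
have [mon _] := mops.
have kn : 1 + p != 0 by rewrite gt_eqF //; lra.
have B2E i j : B2 i j = subleading2 al be p i j.
  rewrite /B2 /mx22 !mxE /subleading2.
  by case: (ord2P i) => ->; case: (ord2P j) => -> /=; field; rewrite ?kn.
pose X i j (n : nat) := subleading al be p i j n%:R.
pose Y i j (n : nat) := subsubleading al be p i j n%:R.
have BE i j n : (2 <= n)%N -> B n i j + (i == j)%:R = X i j n - X i j n.+1.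
  case: n => [//|[//|m]] _.
  have [-> _] := recurrence_coefficients P B C m i j mon tt.
  have [-> _] := MOPS_coefficients al be p P m i j hal hbe hp mops.
  have [-> _] := MOPS_coefficients al be p P m.+1 i j hal hbe hp mops.
  by rewrite subrK.
have CE i j n : (2 <= n)%N -> C n i j = Y i j n - Y i j n.+1
    - ((X i 0 n - X i 0 n.+1) * X 0 j n + (X i 1 n - X i 1 n.+1) * X 1 j n).
  case: n => [//|[//|m]] _.
  have [_ ->] := recurrence_coefficients P B C m i j mon tt.
  have [_ ->] := MOPS_coefficients al be p P m i j hal hbe hp mops.
  have [_ ->] := MOPS_coefficients al be p P m.+1 i j hal hbe hp mops.
  rewrite sum_ord2 !BE //.
  have [-> _] := MOPS_coefficients al be p P m 0 j hal hbe hp mops.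
  by have [-> _] := MOPS_coefficients al be p P m 1 j hal hbe hp mops.
have dX i j : exists2 r, ev_bounded r & exists N0, forall n, (N0 <= n)%N ->
    X i j n - X i j n.+1 = (i == j)%:R + subleading2 al be p i j * invn n ^+ 2 + r n * invn
        n ^+ 3.
  have [c3 H] := expansion_subleading al be p i j hal hbe hp.
  by have := expansion_diff1 (X i j) _ _ _ _ H; rewrite opprK.
split.
  apply: (uniform_bound22 (fun i j n => `|B n i j - B2 i j / n%:R ^+ 2|) (fun n => (n%:R ^+
      3)^-1)).
    by move=> n; rewrite invr_ge0 exprn_ge0.
  move=> i j; have [r [K [N1 HK]] [N0 HN]] := dX i j.
  exists K, (maxn 2 (maxn N0 N1)) => n; rewrite !geq_max => /and3P[n2 h0 h1].
  have -> : B n i j - B2 i j / n%:R ^+ 2 = r n * invn n ^+ 3.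
    rewrite -[B n i j](addrK (i == j)%:R) BE // HN // B2E /invn exprVn; ring.
  by rewrite normrM [X in _ * X]ger0_norm ?exprn_ge0 ?invn_ge0 // /invn exprVn ler_wpM2r ?HK
      // invr_ge0 exprn_ge0.
apply: (uniform_bound22 (fun i j n => `|C n i j - ((1 / 4) *: (1%:M : 'M[R]_2)) i j|) (fun n
    => (n%:R ^+ 2)^-1)).
  by move=> n; rewrite invr_ge0 exprn_ge0.
move=> i j.
have [c2 [c3 HY]] := expansion_subsubleading al be p i j hal hbe hp.
have [r br [N0 H0]] := expansion_diff2 (Y i j) _ _ _ _ HY.
have [t0 HX0] := expansion_subleading al be p 0 j hal hbe hp.
have [t1 HX1] := expansion_subleading al be p 1 j hal hbe hp.
(* The identity commutes with the matrix [subleading2]; this is what cancels the 1 / n terms in the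
   product. *)
have comm : (i == 0)%:R * subleading2 al be p 0 j + (i == 1)%:R * subleading2 al be p 1 j =
    subleading2 al be p i 0 * (0 == j)%:R + subleading2 al be p i 1 * (1 == j)%:R.
  by case: (ord2P i) => ->; case: (ord2P j) => -> /=; ring.
have [s bs [N1 H1]] := expansion_mul_sum _ _ _ _ _ _ _ _ _ _ _ _ _ _ _ _ (dX i 0) (dX i 1)
    HX0 HX1 comm.
have [K [N2 HK]] := ev_boundedD _ _ br (ev_boundedN _ bs).
exists K, (maxn 2 (maxn N0 (maxn N1 N2))) => n.
rewrite !geq_max => /and4P[n2 h0 h1 h2].
have -> : C n i j - ((1 / 4) *: (1%:M : 'M[R]_2)) i j = (r n - s n) * invn n ^+ 2.
  rewrite CE // H0 // H1 // !mxE.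
  by rewrite /subleading1; case: (ord2P i) => ->; case: (ord2P j) => -> /=; field.
by rewrite normrM [X in _ * X]ger0_norm ?exprn_ge0 ?invn_ge0 // /invn exprVn ler_wpM2r ?HK
    // invr_ge0 exprn_ge0.
Qed.
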